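(* Let $\langle X;\mathcal{R}\rangle$ be a presentation of finite type of a discrete group which is combinatorially aspherical (a CA-presentation). Then $\langle X;\mathcal{R}\rangle$ is quasirational, and every subpresentation $\langle X;\mathcal{R}_0\rangle$ with $\mathcal{R}_0\subseteq\mathcal{R}$ is quasirational.
   Context: A presentation of finite type $\langle X;\mathcal{R}\rangle$ has $X$ finite and $\mathcal{R}$ a finite subset of the free group $F$ on $X$. With $R$ the normal closure of $\mathcal{R}$ in $F$ and $G=F/R$, it is identified with the exact sequence $1\to R\to F\to G\to 1$. For a prime $p$, the Zassenhaus $p$-filtration of $F$ is $\mathcal{M}_n=\mathcal{M}_n^{(p)}=\{f\in F\mid f-1\in\Delta_p^n\}$, where $\Delta_p=\ker(\mathbb{F}_pF\to\mathbb{F}_p)$. A discrete presentation is quasirational if for every $n>0$ and every prime $p$ the $F/R\mathcal{M}_n^{(p)}$-module $R/[R,R\mathcal{M}_n^{(p)}]$ has no $p$-torsion. Combinatorial asphericity (Chiswell–Collins–Huebschmann): an identity sequence over $\langle X;\mathcal{R}\rangle$ is a finite sequence $(c_1,\dots,c_m)$ of elements of $F$, each of the form $c_i=w_i r_i^{\varepsilon_i}w_i^{-1}$ with $w_i\in F$, $r_i\in\mathcal{R}$, $\varepsilon_i=\pm1$, with $c_1c_2\cdots c_m=1$ in $F$. The Peiffer operations are: replacing a consecutive pair $(c_i,c_{i+1})$ by $(c_{i+1},c_{i+1}^{-1}c_ic_{i+1})$ or by $(c_ic_{i+1}c_i^{-1},c_i)$; deleting a consecutive pair $(c,c^{-1})$;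 inserting a consecutive pair $(c,c^{-1})$ with $c$ a conjugate of an element of $\mathcal{R}^{\pm1}$. The presentation is combinatorially aspherical (CA) if every identity sequence can be transformed to the empty sequence by finitely many Peiffer operations. In particular its relation module $R/[R,R]$ is a permutation $G$-module. *)

(* Defs.v *)
From HB Require Import structures.
From Stdlib Require Import Relation_Operators.
From mathcomp Require Import all_boot all_algebra finmap.
From mathcomp Require Import monalg.

Set Implicit Arguments.
Unset Strict Implicit.
Unset Printing Implicit Defensive.

Import GRing.Theory.

(* A letter (x, b) stands for x if b = false and for x^-1 if b = true. *)
Section FreeGroup.
Variable X : choiceType.
Implicit Types (a b : X * bool) (s t : seq (X * bool)).

Definition flip a : X * bool := (a.1, ~~ a.2).

Definition reduced s := sorted (fun a b => b != flip a) s.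

Record free_group := FreeWord { free_word :> seq (X * bool); _ : reduced free_word }.

HB.instance Definition _ := [isSub for free_word].
HB.instance Definition _ := [Choice of free_group by <:].

(* The reduced form of a :: s when s is reduced. *)
Definition push a s := if s is b :: t then if b == flip a then t else a :: s else [:: a].

Lemma flipK : involutive flip.
Proof. by case=> x b; rewrite /flip negbK. Qed.

Lemma flip_neq a : (a == flip a) = false.
Proof. by case: a => x b; rewrite /flip xpair_eqE /=; case: b; rewrite andbF. Qed.

Lemma reduced_behead a s : reduced (a :: s) -> reduced s.
Proof. exact: path_sorted. Qed.

Lemma push_reduced a s : reduced s -> reduced (push a s).
Proof.
case: s => [|b t] //= rs; case: eqP => [_|/eqP ne]; first exact: reduced_behead rs.
by rewrite /reduced /= ne.
Qed.

Lemma pushK a s : reduced s -> push (flip a) (push a s) = s.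
Proof.
case: s => [|b t] /=; first by rewrite flipK eqxx.
case: eqP => [-> rs|_ _] /=; last by rewrite flipK eqxx.
by case: t rs => [//|c t] /= /andP[/negPf->].
Qed.

Lemma pushVK a s : reduced s -> push a (push (flip a) s) = s.
Proof. by move=> rs; rewrite -{1}[a]flipK pushK. Qed.

Lemma push_cons a s : reduced (a :: s) -> push a s = a :: s.
Proof. by case: s => [|b t] //= /andP[/negPf->]. Qed.

Definition pushs s t := foldr push t s.

Lemma pushs_reduced s t : reduced t -> reduced (pushs s t).
Proof. by move=> rt; elim: s => //= a s; apply: push_reduced. Qed.

Lemma pushs_id s : reduced s -> pushs s [::] = s.
Proof. by elim: s => //= a s IH rs; rewrite IH ?push_cons //; apply: reduced_behead rs. Qed.

Lemma pushs_push a s t : reduced t -> pushs (push a s) t = push a (pushs s t).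
Proof.
move=> rt; case: s => [|b s] //=; case: eqP => [->|//].
by rewrite pushVK //; apply: pushs_reduced.
Qed.

Lemma pushsA s t u : reduced u -> pushs s (pushs t u) = pushs (pushs s t) u.
Proof. by move=> ru; elim: s => //= a s ->; rewrite pushs_push. Qed.

Definition winv s := rev (map flip s).

Lemma winv_cons a s : winv (a :: s) = rcons (winv s) (flip a).
Proof. by rewrite /winv /= rev_cons. Qed.

Lemma winv_reduced s : reduced s -> reduced (winv s).
Proof.
rewrite /reduced /winv rev_sorted sorted_map.
apply: sub_sorted => a b; apply: contra => /eqP e.
by rewrite -[b]flipK -e.
Qed.

Lemma pushs_winv s t : reduced t -> pushs (winv s) (pushs s t) = t.
Proof.
elim: s t => //= a s IH t rt; rewrite winv_cons /pushs foldr_rcons.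
rewrite -!/(pushs _ _) pushK; last exact: pushs_reduced.
exact: IH.
Qed.

Lemma winvK : involutive winv.
Proof. by move=> s; rewrite /winv map_rev revK -map_comp map_id_in // => a _; apply: flipK. Qed.

Implicit Types u v w : free_group.

Lemma free_wordP u : reduced u. Proof. by case: u. Qed.

Definition free_one := FreeWord (isT : reduced [::]).
Definition free_mul u v := FreeWord (pushs_reduced u (free_wordP v)).
Definition free_inv u := FreeWord (winv_reduced (free_wordP u)).

Lemma free_mulA : associative free_mul.
Proof. by move=> u v w; apply: val_inj; rewrite /= pushsA // free_wordP. Qed.
Lemma free_mul1 : left_id free_one free_mul.
Proof. by move=> u; apply: val_inj. Qed.
Lemma free_mulr1 : right_id free_one free_mul.
Proof. by move=> u; apply: val_inj; rewrite /= pushs_id // free_wordP. Qed.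
Lemma free_mulV : left_inverse free_one free_inv free_mul.
Proof.
move=> u; apply: val_inj; rewrite /= -[X in pushs _ X]pushs_id ?free_wordP //.
by rewrite pushs_winv.
Qed.
Lemma free_mulrV : right_inverse free_one free_inv free_mul.
Proof.
move=> u; apply: val_inj; rewrite /= -{1}[val u]winvK.
rewrite -[X in pushs _ X]pushs_id ?pushs_winv //.
exact/winv_reduced/free_wordP.
Qed.

HB.instance Definition _ := isGroup.Build free_group
  free_mulA free_mul1 free_mulr1 free_mulV free_mulrV.

Definition free_gen (x : X) : free_group := FreeWord (isT : reduced [:: (x, false)]).

Section Lift.
Local Open Scope group_scope.
Variables (H : groupType) (f : X -> H).

Definition letter_lift a : H := if a.2 then (f a.1)^-1 else f a.1.
Definition free_lift u : H := \prod_(a <- free_word u) letter_lift a.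

Lemma letter_lift_flip a : letter_lift (flip a) = (letter_lift a)^-1.
Proof. by case: a => x [] /=; rewrite /letter_lift /= ?invgK. Qed.

Lemma free_liftM : {morph free_lift : u v / u * v}.
Proof.
move=> u v; rewrite /free_lift /=; elim: (free_word u) => [|a s IH] /=.
  by rewrite big_nil mul1g.
rewrite big_cons -mulgA -IH; case: (pushs s v) => [|b t] /=.
  by rewrite big_seq1 big_nil mulg1.
case: eqP => [->|_]; last by rewrite big_cons.
by rewrite big_cons letter_lift_flip mulVKg.
Qed.

Lemma free_lift_gen x : free_lift (free_gen x) = f x.
Proof. by rewrite /free_lift big_seq1. Qed.

Lemma free_lift_unique (g : free_group -> H) :
  {morph g : u v / u * v} -> (forall x, g (free_gen x) = f x) -> g =1 free_lift.
Proof.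
move=> gM gE; have g1 : g 1 = 1 by apply: (mulgI (g 1)); rewrite -gM !mulg1.
have gV u : g u^-1 = (g u)^-1 by apply: (mulgI (g u)); rewrite -gM !mulgV.
case=> s rs; rewrite /free_lift /=; elim: s rs => [|[x b] s IH] rs.
  by rewrite big_nil -g1; congr g; apply: val_inj.
rewrite big_cons -(IH (reduced_behead rs)).
have -> : letter_lift (x, b) = g (if b then (free_gen x)^-1 else free_gen x).
  by case: b {rs}; rewrite /letter_lift /= ?gV gE.
rewrite -gM; congr g; apply: val_inj => /=.
by case: b rs => rs /=; rewrite [RHS](push_cons rs).
Qed.

End Lift.
End FreeGroup.

Section GroupAlgebra.
Local Open Scope ring_scope.
Variables (R : nzRingType) (G : groupType).

(* [monalg] makes {malg R[K]} a ring only when the monoid K has no nontrivial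
   units, so the ring structure of the group algebra has to be built here. *)
Definition group_algebra := {malg R[G]}.
HB.instance Definition _ := GRing.Lmodule.on group_algebra.

Implicit Types a b c : group_algebra.

Definition ga_elt (x : G) : group_algebra := mkmalgU x 1.

Definition ga_mul a b : group_algebra :=
  \sum_(x <- msupp a) \sum_(y <- msupp b) mkmalgU (x * y)%g (mcoeff x a * mcoeff y b).

Lemma ga_mulEw (d1 d2 : {fset G}) a b : (msupp a `<=` d1)%fset -> (msupp b `<=` d2)%fset ->
  ga_mul a b = \sum_(x <- d1) \sum_(y <- d2) mkmalgU (x * y)%g (mcoeff x a * mcoeff y b).
Proof.
move=> le1 le2; rewrite /ga_mul (big_fset_incl _ le1) /=.
  apply: eq_bigr => x _; apply: big_fset_incl => // y _ /mcoeff_outdom ->.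
  by rewrite mulr0 monalgU0.
by move=> x _ /mcoeff_outdom ax0; rewrite big1 // => y _; rewrite ax0 mul0r monalgU0.
Qed.

Lemma ga_mulDl : left_distributive ga_mul +%R.
Proof.
move=> a b c; rewrite (ga_mulEw (msuppD_le a b) (fsubset_refl _)).
rewrite (ga_mulEw (fsubsetUl (msupp a) (msupp b)) (fsubset_refl (msupp c))).
rewrite (ga_mulEw (fsubsetUr (msupp a) (msupp b)) (fsubset_refl (msupp c))).
rewrite -big_split /=; apply: eq_bigr => x _; rewrite -big_split /=.
by apply: eq_bigr => y _; rewrite mcoeffD mulrDl monalgUD.
Qed.

Lemma ga_mulDr : right_distributive ga_mul +%R.
Proof.
move=> c a b; rewrite (ga_mulEw (fsubset_refl _) (msuppD_le a b)).
rewrite (ga_mulEw (fsubset_refl (msupp c)) (fsubsetUl (msupp a) (msupp b))).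
rewrite (ga_mulEw (fsubset_refl (msupp c)) (fsubsetUr (msupp a) (msupp b))).
rewrite -big_split /=; apply: eq_bigr => x _; rewrite -big_split /=.
by apply: eq_bigr => y _; rewrite mcoeffD mulrDr monalgUD.
Qed.

Lemma ga_mul0 : left_zero 0 ga_mul.
Proof. by move=> a; rewrite /ga_mul msupp0 big_seq_fset0. Qed.

Lemma ga_mulr0 : right_zero 0 ga_mul.
Proof. by move=> a; rewrite /ga_mul; apply: big1 => x _; rewrite msupp0 big_seq_fset0. Qed.

Lemma ga_mulUU x y (r s : R) :
  ga_mul (mkmalgU x r) (mkmalgU y s) = mkmalgU (x * y)%g (r * s).
Proof. by rewrite (ga_mulEw msuppU_le msuppU_le) !big_seq_fset1 !mcoeffUU. Qed.

Lemma ga_mul_suml I (s : seq I) (F : I -> group_algebra) b :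
  ga_mul (\sum_(i <- s) F i) b = \sum_(i <- s) ga_mul (F i) b.
Proof. exact: (big_morph (ga_mul^~ b) (fun a c => ga_mulDl a c b) (ga_mul0 b)). Qed.

Lemma ga_mul_sumr I (s : seq I) (F : I -> group_algebra) a :
  ga_mul a (\sum_(i <- s) F i) = \sum_(i <- s) ga_mul a (F i).
Proof. exact: (big_morph (ga_mul a) (ga_mulDr a) (ga_mulr0 a)). Qed.

Lemma ga_sumE a : a = \sum_(x <- msupp a) mkmalgU x (mcoeff x a).
Proof. exact: monalgE. Qed.

Lemma ga_mulA : associative ga_mul.
Proof.
move=> a b c; rewrite [a]ga_sumE ga_mul_suml (ga_mul_suml _ _ b) (ga_mul_suml _ _ c).
apply: eq_bigr => x _; rewrite [b]ga_sumE (ga_mul_suml _ _ c).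
rewrite !(ga_mul_sumr _ _ (mkmalgU x _)) (ga_mul_suml _ _ c).
apply: eq_bigr => y _; rewrite [c]ga_sumE.
rewrite (ga_mul_sumr _ _ (mkmalgU y _)) (ga_mul_sumr _ _ (mkmalgU x _)) ga_mulUU.
rewrite (ga_mul_sumr _ _ (mkmalgU (x * y)%g _)).
by apply: eq_bigr => z _; rewrite !ga_mulUU mulrA mulgA.
Qed.

Lemma ga_mul1 : left_id (ga_elt 1%g) ga_mul.
Proof.
move=> a; rewrite [a in LHS]ga_sumE [RHS]ga_sumE ga_mul_sumr.
by apply: eq_bigr => x _; rewrite ga_mulUU mul1r mul1g.
Qed.

Lemma ga_mulr1 : right_id (ga_elt 1%g) ga_mul.
Proof.
move=> a; rewrite [a in LHS]ga_sumE [RHS]ga_sumE ga_mul_suml.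
by apply: eq_bigr => x _; rewrite ga_mulUU mulr1 mulg1.
Qed.

Lemma ga_1_neq0 : ga_elt 1%g != 0.
Proof. by rewrite monalgU_eq0 oner_eq0. Qed.

HB.instance Definition _ := GRing.Zmodule_isNzRing.Build group_algebra
  ga_mulA ga_mul1 ga_mulr1 ga_mulDl ga_mulDr ga_1_neq0.

Lemma ga_eltM : {morph ga_elt : x y / (x * y)%g >-> x * y}.
Proof. by move=> x y; rewrite /ga_elt [RHS]ga_mulUU mulr1. Qed.

Definition augmentation a : R := \sum_(x <- msupp a) mcoeff x a.

Lemma augmentationEw (d : {fset G}) a :
  (msupp a `<=` d)%fset -> augmentation a = \sum_(x <- d) mcoeff x a.
Proof. by move=> le; apply: big_fset_incl => // x _ /mcoeff_outdom. Qed.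

Lemma augmentationU x r : augmentation (mkmalgU x r) = r.
Proof. by rewrite (augmentationEw msuppU_le) big_seq_fset1 mcoeffUU. Qed.

Lemma augmentation_is_zmod_morphism : zmod_morphism augmentation.
Proof.
move=> a b; rewrite (augmentationEw (msuppB_le a b)).
rewrite (augmentationEw (fsubsetUl (msupp a) (msupp b))).
rewrite (augmentationEw (fsubsetUr (msupp a) (msupp b))).
by rewrite -sumrB; apply: eq_bigr => x _; rewrite mcoeffB.
Qed.

HB.instance Definition _ :=
  GRing.isZmodMorphism.Build group_algebra R augmentation augmentation_is_zmod_morphism.

Lemma augmentation_is_monoid_morphism : monoid_morphism augmentation.
Proof.
split=> [|a b]; first exact: augmentationU.
rewrite [a * b]/(ga_mul a b) raddf_sum mulr_suml; apply: eq_bigr => x _.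
rewrite raddf_sum mulr_sumr; apply: eq_bigr => y _; exact: augmentationU.
Qed.

HB.instance Definition _ :=
  GRing.isMonoidMorphism.Build group_algebra R augmentation augmentation_is_monoid_morphism.

Definition augmentation_ideal a : Prop := augmentation a = 0.

End GroupAlgebra.

Section Ideals.
Local Open Scope ring_scope.
Variable A : nzRingType.

Definition ideal_mul (I J : A -> Prop) (a : A) : Prop :=
  exists2 s : seq (A * A),
    forall u, u \in s -> I u.1 /\ J u.2 & a = \sum_(u <- s) u.1 * u.2.

Fixpoint ideal_exp (I : A -> Prop) n : A -> Prop :=
  if n is n'.+1 then ideal_mul I (ideal_exp I n') else fun=> True.

End Ideals.

Local Open Scope group_scope.

Section Subgroups.
Variable G : groupType.
Implicit Types (S A B : G -> Prop).

Inductive generated S : G -> Prop :=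
| gen_in x : S x -> generated S x
| gen_1 : generated S 1
| gen_M x y : generated S x -> generated S y -> generated S (x * y)
| gen_V x : generated S x -> generated S x^-1.

Definition normal_closure S : G -> Prop :=
  generated (fun y => exists w x, S x /\ y = w * x * w^-1).

Definition set_mul A B : G -> Prop := fun z => exists x y, [/\ A x, B y & z = x * y].

Definition commutator A B : G -> Prop :=
  generated (fun z => exists x y, [/\ A x, B y & z = [~ x, y]]).

(* No p-torsion in the quotient A / B, for B a normal subgroup of the subgroup A:
   a coset a B whose order is a power of p is trivial. *)
Definition quotient_no_ptorsion (p : nat) A B : Prop :=
  forall (a : G) (k : nat), A a -> B (a ^+ (p ^ k)%N) -> B a.

Definition zassenhaus (p n : nat) : G -> Prop :=
  fun f => ideal_exp (@augmentation_ideal 'F_p G) n (ga_elt 'F_p f - 1)%R.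

End Subgroups.

Section Presentations.
Variable X : finType.

Notation F := (free_group X).

Definition presentation := {fset F}.

Implicit Type Rel : presentation.

Definition relation_subgroup Rel : F -> Prop := normal_closure (fun r => r \in Rel).

(* p-torsion refers to the abelian group underlying the F / R M_n-module
   R / [R, R M_n]; the conjugation action plays no role in it. *)
Definition quasirational Rel : Prop :=
  forall n p : nat, 0 < n -> prime p ->
    let R := relation_subgroup Rel in
    quotient_no_ptorsion p R (commutator R (set_mul R (@zassenhaus F p n))).

Definition relator_conjugate Rel (c : F) : Prop :=
  exists (w r : F) (e : bool), r \in Rel /\ c = w * (if e then r^-1 else r) * w^-1.

Definition identity_sequence Rel (s : seq F) : Prop :=
  (forall c, c \in s -> relator_conjugate Rel c) /\ \prod_(c <- s) c = 1.

(* In the delete step no condition on c is needed: the sequences reached from an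
   identity sequence only contain conjugates of relators and their inverses. *)
Inductive peiffer_step Rel : seq F -> seq F -> Prop :=
| peiffer_exchange_l s t c d :
    peiffer_step Rel (s ++ [:: c; d] ++ t) (s ++ [:: d; d^-1 * c * d] ++ t)
| peiffer_exchange_r s t c d :
    peiffer_step Rel (s ++ [:: c; d] ++ t) (s ++ [:: c * d * c^-1; c] ++ t)
| peiffer_delete s t c :
    peiffer_step Rel (s ++ [:: c; c^-1] ++ t) (s ++ t)
| peiffer_insert s t c : relator_conjugate Rel c ->
    peiffer_step Rel (s ++ t) (s ++ [:: c; c^-1] ++ t).

Definition combinatorially_aspherical Rel : Prop :=
  forall s, identity_sequence Rel s -> clos_refl_trans _ (peiffer_step Rel) s [::].

End Presentations.

(* Main.v *)
(** The relation module of a combinatorially aspherical presentation is governed by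
signed conjugacy classes of relators: a function on relator conjugates that is odd
and invariant under conjugation by R extends to a homomorphism on R.  For a
subpresentation with relation subgroup R0, the task is to extend odd functions on
its relator conjugates that are only invariant under U = <R0 M_n> to R0.  Such an
extension is a crossed homomorphism R -> A, where A is the R-module of functions
F -> Z that are right U-invariant, and the conjugates of R0 act trivially on A.
Modulo p^k the module A is unipotent, because F_p F / Delta^n is finite dimensional
and so right M_n-invariant functions are polynomial.  Climbing the resulting finite
filtration, each step is the case of trivial coefficients followed by a lift of a
crossed homomorphism along a surjection of modules, which exists since R is a
subgroup of a free group.  Letting k grow, the signed number of relators in a given
U-class is a well-defined homomorphism R0 -> Z.  These homomorphisms separate
R0 / [R0, R0 M_n], because no nontrivial element of a free group is conjugate to its
inverse; hence the quotient is torsion-free. *)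

Require Import Defs.
From Stdlib Require Import Relation_Operators.
From mathcomp Require Import all_boot all_order all_algebra finmap zify.
From mathcomp Require Import monalg boolp functions finfield.

Set Implicit Arguments.
Unset Strict Implicit.
Unset Printing Implicit Defensive.

Import Order.TTheory GRing.Theory Num.Theory.

(** * Conjugation in free groups *)

Section FreeWords.
Local Open Scope group_scope.
Variable X : choiceType.
Notation F := (free_group X).
Implicit Types (a b : X * bool) (s t u v w : seq (X * bool)).

Definition free_letter a : F := FreeWord (isT : reduced [:: a]).
Definition free_eval s : F := \prod_(a <- s) free_letter a.

Lemma free_letterV a : free_letter (flip a) = (free_letter a)^-1.
Proof. by apply: val_inj. Qed.

Lemma free_eval_cat s t : free_eval (s ++ t) = free_eval s * free_eval t.
Proof. exact: big_cat. Qed.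

Lemma free_eval_cons a s : free_eval (a :: s) = free_letter a * free_eval s.
Proof. exact: big_cons. Qed.

Lemma free_eval_winv s : free_eval (winv s) = (free_eval s)^-1.
Proof.
elim: s => [|a s IH]; first by rewrite /free_eval big_nil invg1.
rewrite free_eval_cons winv_cons -cats1 free_eval_cat invgM IH; congr (_ * _).
by rewrite /free_eval big_seq1 free_letterV.
Qed.

Lemma word_free_eval s : reduced s -> free_word (free_eval s) = s.
Proof.
elim: s => [|a s IH] rs; first by rewrite /free_eval big_nil.
by rewrite free_eval_cons /= IH ?(reduced_behead rs) // push_cons.
Qed.

Lemma free_evalK (f : F) : free_eval (free_word f) = f.
Proof. by apply: val_inj; apply: word_free_eval (free_wordP f). Qed.

(* Reduced words that are also reduced cyclically are the [cycle noncancel] ones. *)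
Definition noncancel a b := b != flip a.

Lemma reduced_between a s : reduced s -> head a s != flip a -> last a s != a ->
  s != [::] -> reduced (a :: rcons s (flip a)).
Proof.
case: s => [//|b s] rs /= nb nl _; rewrite /reduced /= nb rcons_path /=.
rewrite [path _ _ _]rs /=; apply: contra nl => /eqP/(congr1 (@flip X)).
by rewrite !flipK => <-.
Qed.

Lemma cycle_reduced s : cycle noncancel s -> reduced s.
Proof. by case: s => //= b s; rewrite rcons_path => /andP[]. Qed.

Definition rotation s t := exists2 i, i <= size s & t = rot i s.

Lemma rotation_trans s t u : rotation s t -> rotation t u -> rotation s u.
Proof.
move=> [i is_ ->] [j]; rewrite size_rot => js ->.
rewrite rot_add_mod //; set m := if _ then _ else _; exists m => //.
by rewrite /m; case: ifP => // _; rewrite leq_subLR leq_add.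
Qed.

Lemma rotation_cycle s t : rotation s t -> cycle noncancel s -> cycle noncancel t.
Proof. by case=> i _ ->; rewrite rot_cycle. Qed.

Lemma rotation_size s t : rotation s t -> size t = size s.
Proof. by case=> i _ ->; rewrite size_rot. Qed.

(** Induction on [w]: conjugation by one more letter cancels against the ends of [v], or rotates
    [t'] by one letter when [v] is empty, or else lengthens [v]. *)
Lemma conjugate_rotation t w : cycle noncancel t -> t != [::] ->
  exists v t', [/\ rotation t t', reduced (v ++ t' ++ winv v) &
    free_eval w * free_eval t * (free_eval w)^-1 = free_eval (v ++ t' ++ winv v)].
Proof.
move=> ct nt; elim: w => [|a w [v [t' [rot_t rv e]]]].
  exists [::], t; split; first by exists 0; rewrite ?rot0.
    by rewrite cats0; apply: cycle_reduced.
  by rewrite cats0 {1 3}/free_eval big_nil mul1g invg1 mulg1.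
have {}e : free_eval (a :: w) * free_eval t * (free_eval (a :: w))^-1
    = free_eval (a :: rcons (v ++ t' ++ winv v) (flip a)).
  rewrite !free_eval_cons -cats1 free_eval_cat -e [free_eval [:: _]]big_seq1.
  by rewrite free_letterV invgM !mulgA.
rewrite {}e; have ct' := rotation_cycle rot_t ct.
have nt' : t' != [::] by rewrite -size_eq0 (rotation_size rot_t) size_eq0.
have cancel_l b s : free_eval (flip b :: b :: s) = free_eval s.
  by rewrite !free_eval_cons free_letterV mulKg.
have cancel_r b s : free_eval (rcons (rcons s b) (flip b)) = free_eval s.
  rewrite -!cats1 !free_eval_cat [free_eval [:: b]]big_seq1.
  by rewrite [free_eval [:: _]]big_seq1 free_letterV mulgK.
have [ha|ha] := eqVneq (head a (v ++ t' ++ winv v)) (flip a).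
  case: v rv ha => [|b v] rv ha.
    case: t' rot_t ct' nt' rv ha => // b t' rot_t ct' _ _; rewrite /= cats0 => ha.
    have rot_b : rotation t (rcons t' b).
      by apply: rotation_trans rot_t _; exists 1%N; rewrite // rot1_cons.
    exists [::], (rcons t' b); split=> //.
      by rewrite cats0; apply/cycle_reduced/(rotation_cycle rot_b).
    by rewrite cats0 ha -[X in X :: flip a :: _]flipK cancel_l.
  exists v, t'; rewrite /= in rv ha *; split=> //.
    move: (reduced_behead rv); rewrite winv_cons -cats1 !catA.
    by move=> /cat_sorted2[]; rewrite -!catA.
  have -> : a = flip b by rewrite ha flipK.
  rewrite flipK cancel_l winv_cons -!rcons_cat.
  by have := cancel_r (flip b); rewrite flipK => ->.
(* When the last letter is [a], [v] must be empty: otherwise the first letter would be [flip a],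
   which is the previous case. *)
have [la|la] := eqVneq (last a (v ++ t' ++ winv v)) a.
  case: v rv ha la => [|b v] rv ha la; last first.
    move: la ha; rewrite /= winv_cons -rcons_cat -rcons_cat last_rcons.
    by move=> <-; rewrite flipK eqxx.
  case/lastP: t' rot_t ct' nt' rv ha la => // t' b rot_t ct' _ _ _.
  rewrite /= cats0 last_rcons => ba; rewrite {}ba in rot_t ct' *.
  have rot_b : rotation t (a :: t').
    apply: rotation_trans rot_t _; exists (size t'); rewrite ?size_rcons //.
    by rewrite -cats1 rot_size_cat.
  exists [::], (a :: t'); split=> //.
    by rewrite cats0; apply/cycle_reduced/(rotation_cycle rot_b).
  by rewrite -!rcons_cons cancel_r cats0.
exists (a :: v), t'; split=> //; rewrite winv_cons /= -!rcons_cat //.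
by apply: reduced_between => //; case: (v) => //; case: (t') nt'.
Qed.

(** First and last letters are mutually inverse, so the middle is again fixed; the descent would end
    in a letter equal to its own inverse or in an adjacent cancelling pair. *)
Lemma winv_fixed s : reduced s -> winv s = s -> s = [::].
Proof.
have [n le_n] := ubnP (size s); elim: n s le_n => // n IH [//|x s].
case/lastP: s => [|s z] le_n rs.
  by rewrite winv_cons /= => -[/eqP]; rewrite eq_sym flip_neq.
rewrite winv_cons {1}/winv map_rcons rev_rcons -/(winv s) /= => -[zx /rcons_inj[sE _]].
have rs' : reduced s.
  by move: (reduced_behead rs); rewrite -cats1 => /cat_sorted2[].
have s0 : s = [::].
  by apply: IH => //; move: le_n; rewrite /= size_rcons => /ltnW; rewrite !ltnS.
by move: rs; rewrite s0 /= -zx flipK eqxx.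
Qed.

(** Induction on length. A nontrivial cyclically reduced [c] would have its inverse among its own
    rotations; any other one is [a * s * a^-1], and the claim passes to [s]. *)
Lemma conjugate_inverse (c y : F) : y * c * y^-1 = c^-1 -> c = 1.
Proof.
have [n le_n] := ubnP (size c); elim: n c y le_n => // n IH c y le_n yc.
have [c0|c0] := eqVneq (free_word c) [::]; first exact: val_inj.
have [cc|] := boolP (cycle noncancel c).
  have [v [t [[i _ tE] rt]]] := conjugate_rotation (free_word y) cc c0.
  rewrite !free_evalK yc -{1}[c]free_evalK -free_eval_winv => /(congr1 (@free_word X)).
  rewrite !word_free_eval ?winv_reduced ?free_wordP // => e.
  (* By comparison of lengths, since [c^-1] is as long as [c]. *)
  have v0 : v = [::].
    apply: size0nil; move/(congr1 size): e; rewrite !size_cat tE size_rot.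
    by rewrite ![size (winv _)]size_rev !size_map; lia.
  (* Blocks of equal length are compared: both pieces of [c] cut by the rotation are fixed by
     [winv], hence empty. *)
  move: e; rewrite v0 cats0 tE /= -{1}[free_word c](cat_take_drop i) /rot.
  rewrite /winv map_cat rev_cat => /eqP; rewrite eqseq_cat; last first.
    by rewrite size_rev size_map.
  move/andP => [/eqP d0 /eqP t0].
  have := free_wordP c; rewrite -[free_word c](cat_take_drop i).
  move/cat_sorted2 => [/winv_fixed/(_ t0) tk /winv_fixed/(_ d0) dr].
  by move: c0; rewrite -[free_word c](cat_take_drop i) tk dr.
case cE : (free_word c) c0 => [//|a s] _.
case/lastP: s cE => [|s b] cE /=.
  by rewrite /noncancel flip_neq.
rewrite rcons_path last_rcons => ncc.
have rc := free_wordP c; rewrite cE in rc.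
have {ncc} bE : b = flip a.
  move: ncc; rewrite [path _ _ _]rc /= negbK => /eqP ->; by rewrite flipK.
have rs : reduced s by move: (reduced_behead rc); rewrite -cats1 => /cat_sorted2[].
have cs : c = free_letter a * free_eval s * (free_letter a)^-1.
  rewrite -[c]free_evalK cE bE -cats1 free_eval_cons free_eval_cat.
  by rewrite [free_eval [:: _]]big_seq1 free_letterV mulgA.
have s1 : free_eval s = 1.
  apply: (IH _ ((free_letter a)^-1 * y * free_letter a)).
    rewrite word_free_eval //; move: le_n; rewrite cE /= size_rcons => /ltnW.
    by rewrite ltnS.
  apply: (mulgI (free_letter a)); apply: (mulIg (free_letter a)^-1).
  move: yc; rewrite cs !invgM !invgK !mulgA => <-.
  by rewrite !mulgV !mul1g ?mulgK.
by rewrite cs s1 mulg1 mulgV.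
Qed.
End FreeWords.

(** * Powers of the augmentation ideal of a free group algebra *)

Section GroupAlgebraScaling.
Local Open Scope ring_scope.
Variables (K : comNzRingType) (G : groupType).
Notation A := (group_algebra K G).
Implicit Types (a b : A) (c : K).

Lemma ga_scaleU c (x : G) (r : K) : c *: (mkmalgU x r : A) = (mkmalgU x (c * r) : A).
Proof. by apply/malgP => y; rewrite mcoeffZ !mcoeffU mulrnAr. Qed.

Lemma ga_scaleE c a : c *: a = (mkmalgU 1%g c : A) * a.
Proof.
rewrite {1}[a]ga_sumE scaler_sumr [X in _ * X]ga_sumE mulr_sumr.
apply: eq_bigr => x _.
by rewrite ga_scaleU [RHS]ga_mulUU mul1g.
Qed.

Lemma ga_scaleAr c a b : c *: (a * b) = a * (c *: b).
Proof.
rewrite !ga_scaleE !mulrA; congr (_ * _).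
rewrite [a]ga_sumE mulr_sumr mulr_suml; apply: eq_bigr => x _.
by rewrite [LHS]ga_mulUU [RHS]ga_mulUU mul1g mulg1 mulrC.
Qed.

Notation D := (ideal_exp (@augmentation_ideal K G)).

Lemma ideal_expS n a b : augmentation a = 0 -> D n b -> D n.+1 (a * b).
Proof.
move=> a0 Db; exists [:: (a, b)]; last by rewrite big_seq1.
by move=> u; rewrite inE => /eqP->.
Qed.

Lemma ideal_exp0 n : D n 0.
Proof. by case: n => [//|n]; exists [::] => //; rewrite big_nil. Qed.

Lemma ideal_expD n a b : D n a -> D n b -> D n (a + b).
Proof.
case: n => [//|n] [s Ds ->] [t Dt ->]; exists (s ++ t); last by rewrite big_cat.
by move=> u; rewrite mem_cat => /orP[/Ds|/Dt].
Qed.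

Lemma ideal_expMl n a b : D n b -> D n (a * b).
Proof.
case: n => [//|n] [s Ds ->]; exists [seq (a * u.1, u.2) | u <- s].
  move=> _ /mapP[u /Ds[a0 Du] ->]; split=> //.
  by rewrite /augmentation_ideal rmorphM [X in _ * X]a0 mulr0.
by rewrite big_map mulr_sumr; apply: eq_bigr => u _; rewrite mulrA.
Qed.

Lemma ideal_expZ n c a : D n a -> D n (c *: a).
Proof. by rewrite ga_scaleE; apply: ideal_expMl. Qed.

Lemma ideal_expB n a b : D n a -> D n b -> D n (a - b).
Proof. by move=> Da Db; apply: ideal_expD Da _; rewrite -scaleN1r; apply: ideal_expZ. Qed.

Lemma ideal_exp_sum n (I : Type) (s : seq I) (E : I -> A) :
  (forall i, D n (E i)) -> D n (\sum_(i <- s) E i).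
Proof.
move=> DE; elim/big_rec: _ => [|i a _ Da]; first exact: ideal_exp0.
exact: ideal_expD.
Qed.

Lemma augmentation_elt (x : G) : augmentation (ga_elt K x) = 1.
Proof. exact: augmentationU. Qed.

Lemma augmentation_eltB1 (x : G) : augmentation (ga_elt K x - 1) = 0.
Proof. by rewrite raddfB /= augmentation_elt rmorph1 subrr. Qed.

End GroupAlgebraScaling.

Section FreeGroupAlgebra.
Local Open Scope ring_scope.
Variables (K : comNzRingType) (X : finType).
Notation G := (free_group X).
Notation A := (group_algebra K G).
Notation D := (ideal_exp (@augmentation_ideal K G)).
Implicit Types (a b : A) (c : K).

(** A right ideal; by [gens_span_augmentation] it contains the augmentation ideal. *)
Definition gens_span a := exists b : X -> A, a = \sum_x (ga_elt K (free_gen x) - 1) * b x.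

Lemma gens_spanD a b : gens_span a -> gens_span b -> gens_span (a + b).
Proof.
move=> [u ->] [v ->]; exists (fun x => u x + v x).
by rewrite -big_split; apply: eq_bigr => x _; rewrite mulrDr.
Qed.

Lemma gens_spanMr a b : gens_span a -> gens_span (a * b).
Proof.
move=> [u ->]; exists (fun x => u x * b).
by rewrite mulr_suml; apply: eq_bigr => x _; rewrite mulrA.
Qed.

Lemma gens_spanZ c a : gens_span a -> gens_span (c *: a).
Proof.
move=> [u ->]; exists (fun x => c *: u x).
by rewrite scaler_sumr; apply: eq_bigr => x _; rewrite ga_scaleAr.
Qed.

Lemma gens_spanN a : gens_span a -> gens_span (- a).
Proof.
move=> [u ->]; exists (fun x => - u x).
by rewrite -sumrN; apply: eq_bigr => x _; rewrite mulrN.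
Qed.

Lemma gens_span0 : gens_span 0.
Proof. by exists (fun=> 0); rewrite big1 // => x _; rewrite mulr0. Qed.

Lemma gens_span_gen x : gens_span (ga_elt K (free_gen x) - 1).
Proof.
exists (fun y => if y == x then 1 else 0); rewrite (bigD1 x) // big1 => [|y /negPf->].
  by rewrite eqxx mulr1 /= addr0.
by rewrite mulr0.
Qed.

(** Fox calculus: [u * v - 1 = (u - 1) * v + (v - 1)] peels off one letter, and
    [x^-1 - 1 = - ((x - 1) * x^-1)] treats inverse letters. *)
Lemma gens_span_elt (f : G) : gens_span (ga_elt K f - 1).
Proof.
rewrite -(free_evalK f); elim: (free_word f) => [|[x e] s IH].
  by rewrite /free_eval big_nil subrr; apply: gens_span0.
rewrite free_eval_cons ga_eltM.
have -> (u v : A) : u * v - 1 = (u - 1) * v + (v - 1).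
  by rewrite mulrBl mul1r addrA subrK.
apply: gens_spanD IH; apply: gens_spanMr.
have gx := gens_span_gen x; case: e; last exact: gx.
have -> : free_letter (x, true) = ((free_gen x)^-1)%g by apply: val_inj.
have uV : ga_elt K (free_gen x) * ga_elt K (free_gen x)^-1%g = 1.
  by rewrite -ga_eltM mulgV.
have invE (u v : A) : u * v = 1 -> v - 1 = - ((u - 1) * v).
  by move=> uv; rewrite mulrBl uv mul1r opprB.
rewrite (invE _ _ uV).
exact/gens_spanN/gens_spanMr.
Qed.

Lemma gens_span_augmentation a : gens_span (a - augmentation a *: (1 : A)).
Proof.
have -> : a - augmentation a *: (1 : A) =
    \sum_(x <- msupp a) mcoeff x a *: (ga_elt K x - 1).
  rewrite {1}[a]ga_sumE scaler_suml -sumrB; apply: eq_bigr => x _.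
  by rewrite scalerBr; congr (_ - _); rewrite ga_scaleU mulr1.
elim/big_rec: _ => [|x b _ gb]; first exact: gens_span0.
by apply: gens_spanD gb; apply/gens_spanZ/gens_span_elt.
Qed.

Definition spans_mod n (I : finType) (v : I -> A) :=
  forall a, exists c : I -> K, D n (a - \sum_i c i *: v i).

(** Every element is a scalar plus a sum of terms [(x - 1) * b x], and multiplication by [x - 1]
    raises the power of the ideal by one; so 1 and the [(x - 1) * v i] span at the next level. *)
Lemma finite_span n : exists (I : finType) (v : I -> A), spans_mod n v.
Proof.
elim: n => [|n [I [v sv]]]; first by exists void, (fun=> 0) => a; exists (fun=> 0).
exists (unit + X * I)%type, (fun j => match j with
  | inl _ => 1 | inr q => (ga_elt K (free_gen q.1) - 1) * v q.2 end) => a.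
have [b bE] := gens_span_augmentation a.
have [c cE] := choice (fun x => sv (b x)).
exists (fun j => match j with inl _ => augmentation a | inr q => c q.1 q.2 end).
set w := (X in D _ X).
have -> : w = \sum_x (ga_elt K (free_gen x) - 1) * (b x - \sum_i c x i *: v i).
  rewrite /w big_sumType (big_pred1 tt) /=; last by case.
  rewrite opprD addrA bE.
  have -> : \sum_q c q.1 q.2 *: ((ga_elt K (free_gen q.1) - 1) * v q.2) =
      \sum_x \sum_i c x i *: ((ga_elt K (free_gen x) - 1) * v i).
    by rewrite pair_bigA.
  rewrite -sumrB.
  apply: eq_bigr => x _; rewrite mulrBr mulr_sumr; congr (_ - _).
  by apply: eq_bigr => i _; rewrite ga_scaleAr.
apply: ideal_exp_sum => x; apply: ideal_expS (cE x); apply: augmentation_eltB1.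
Qed.

End FreeGroupAlgebra.

Lemma subrBA (V : zmodType) (x y z : V) : (x - (y - z) = x - y + z)%R.
Proof. by rewrite opprB addrA addrAC. Qed.

Lemma subrACA (V : zmodType) (x y z t : V) : (x - y - (z - t) = x - z - (y - t))%R.
Proof. by rewrite !opprD !opprK addrACA. Qed.

Lemma scaler_sumB (R : pzRingType) (V : lmodType R) (I : finType) (b c : I -> R) (t : R)
    (v : I -> V) :
  (\sum_i (b i - t * c i) *: v i = \sum_i b i *: v i - t *: \sum_i c i *: v i)%R.
Proof.
rewrite scaler_sumr -sumrB; apply: eq_bigr => i _.
by rewrite scalerBl scalerA.
Qed.

Section Functionals.
Local Open Scope ring_scope.
Variables (K : fieldType) (X : finType) (n : nat).
Notation G := (free_group X).
Notation A := (group_algebra K G).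
Notation D := (ideal_exp (@augmentation_ideal K G)).
Implicit Types (a b : A) (c : K).

Lemma minimal_span_free d (v : 'I_d -> A) : spans_mod n v ->
    (forall d' (w : 'I_d' -> A), spans_mod n w -> (d <= d')%N) ->
  forall c : 'I_d -> K, D n (\sum_i c i *: v i) -> forall i, c i = 0.
Proof.
case: d v => [|d] v sv min c Dc j; first by case: j.
apply/eqP/negP => /negP cj; suff /min : spans_mod n (v \o lift j) by rewrite ltnn.
move=> a; have [b Db] := sv a.
(* Subtracting this multiple of the relation [c] kills coefficient [j], so [v j] could be dropped,
   against minimality. *)
pose b' i := b i - b j / c j * c i; exists (fun i => b' (lift j i)).
have b'j : b' j = 0 by rewrite /b' divfK ?subrr.
have e : \sum_i b' (lift j i) *: v (lift j i) =
    \sum_i b i *: v i - (b j / c j) *: \sum_i c i *: v i.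
  by rewrite -scaler_sumB [RHS](bigD1_ord j) // -/(b' j) b'j scale0r [RHS]add0r.
suff : D n (a - (\sum_i b i *: v i - (b j / c j) *: \sum_i c i *: v i)) by rewrite -e.
by rewrite subrBA; apply: ideal_expD => //; apply: ideal_expZ.
Qed.

(** The functionals are the coordinates in a spanning family of least size, which is a basis modulo
    the [n]-th power of the ideal. *)
Lemma separating_functionals : exists d (l : 'I_d -> A -> K),
  [/\ forall i a b, l i (a - b) = l i a - l i b,
      forall i a, D n a -> l i a = 0
    & forall a, (forall i, l i a = 0) -> D n a].
Proof.
have ex_span : exists d, `[< exists v : 'I_d -> A, spans_mod n v >].
  have [I [v sv]] := finite_span K X n; exists #|I|; apply/asboolP.
  exists (v \o enum_val) => a; have [c Dc] := sv a; exists (c \o enum_val).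
  by move: Dc; rewrite (reindex _ (onW_bij _ (enum_val_bij I))).
have [d /asboolP[v sv] min] := ex_minnP ex_span.
have vfree := minimal_span_free sv (fun d' w sw => min d' (asboolT (ex_intro _ w sw))).
have [c cE] := choice sv.
have uniq a u : D n (a - \sum_i u i *: v i) -> forall i, c a i = u i.
  move=> Du i; apply/eqP; rewrite -subr_eq0; apply/eqP; move: i; apply: vfree.
  have := ideal_expB Du (cE a); set w := (X in D n X -> _).
  suff -> : w = \sum_i (c a i - u i) *: v i by [].
  rewrite /w opprB addrC addrA subrK -sumrB.
  by apply: eq_bigr => i _; rewrite scalerBl.
exists d, (fun i a => c a i); split.
- move=> i a b; apply: (uniq (a - b) (fun i => c a i - c b i)).
  have e : \sum_i c a i *: v i - \sum_i c b i *: v i = \sum_i (c a i - c b i) *: v i.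
    by rewrite -sumrB; apply: eq_bigr => i0 _; rewrite scalerBl.
  by have := ideal_expB (cE a) (cE b); rewrite subrACA e.
- move=> i a Da; apply: (uniq a (fun=> 0)).
  by rewrite big1 ?subr0 // => j _; rewrite scale0r.
move=> a c0; have := cE a.
by rewrite big1 ?subr0 // => j _; rewrite c0 scale0r.
Qed.
End Functionals.

(** * Polynomial maps on a group *)

Lemma finField_expf_pred (K : finFieldType) (x : K) : (x != 0 -> x ^+ #|K|.-1 = 1)%R.
Proof.
move=> x0; apply: (mulfI x0); have K0 : 0 < #|K| by apply/card_gt0P; exists 0%R.
by rewrite mulr1 -exprS prednK // expf_card.
Qed.

Definition right_invariant (G : groupType) (M : G -> Prop) (V : Type) (a : G -> V) : Prop :=
  forall f m, M m -> a (f * m)%g = a f.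

Section PolynomialMaps.
Local Open Scope ring_scope.
Variables (G : groupType) (V : zmodType).
Implicit Types (a b : G -> V) (Z : (G -> V) -> Prop) (y : G).

Definition ldiff y a : G -> V := fun f => a (y * f)%g - a f.

(* For Z the zero functions, these are the functions of degree less than n. *)
Fixpoint poly_map Z n a : Prop :=
  if n is n'.+1 then forall y, poly_map Z n' (ldiff y a) else Z a.

Definition vanishing a : Prop := forall f, a f = 0.

Definition translation_module Z : Prop :=
  [/\ Z (fun=> 0), forall a b, Z a -> Z b -> Z (fun f => a f - b f)
    & forall y a, Z a -> Z (fun f => a (y * f)%g)].

Lemma poly_map_module Z n : translation_module Z -> translation_module (poly_map Z n).
Proof.
move=> modZ; elim: n => // n [IH0 IHB IHt]; split=> [y|a b pa pb y|x a pa y] /=.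
- by have -> : ldiff y (fun=> 0 : V) = (fun=> 0) by apply: funext => f; rewrite /ldiff subrr.
- have -> : ldiff y (fun f => a f - b f) = (fun f => ldiff y a f - ldiff y b f).
    by apply: funext => f; rewrite /ldiff subrACA.
  exact: IHB.
(* Moving the difference past the translation by [x] conjugates [y], which is harmless since [y] is
   arbitrary. *)
have -> : ldiff y (fun f => a (x * f)%g) = (fun f => ldiff (x * y * x^-1)%g a (x * f)%g).
  by apply: funext => f; rewrite /ldiff !mulgA mulgVK.
exact: IHt.
Qed.

Lemma poly_mapD Z n a b : translation_module Z -> poly_map Z n a -> poly_map Z n b ->
  poly_map Z n (fun f => a f + b f).
Proof.
move=> /(poly_map_module n)[p0 pB _] pa pb; have := pB _ _ pa (pB _ _ p0 pb).
by congr poly_map; apply: funext => f; rewrite sub0r opprK.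
Qed.

Lemma poly_mapS Z n a : translation_module Z -> poly_map Z n a -> poly_map Z n.+1 a.
Proof. by move=> /(poly_map_module n)[_ pB pt] pa y; apply: pB (pt _ _ pa) pa. Qed.

Lemma poly_map_le Z m n a : translation_module Z -> (m <= n)%N -> poly_map Z m a -> poly_map Z n a.
Proof.
move=> modZ /subnK <-; elim: (n - m)%N => // k IH /IH; exact: poly_mapS.
Qed.

Lemma poly_map_iter Z m n a : poly_map (poly_map Z n) m a -> poly_map Z (m + n)%N a.
Proof. by elim: m a => // m IH a pa y; apply/IH/pa. Qed.

(** The base condition is exchanged only within a class [I] stable under differences, such as the
    right invariant functions. *)
Lemma poly_map_sub (I Z Z' : (G -> V) -> Prop) n a :
    (forall y b, I b -> I (ldiff y b)) -> (forall b, I b -> Z b -> Z' b) ->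
  I a -> poly_map Z n a -> poly_map Z' n a.
Proof.
move=> Idiff ZZ'; elim: n a => [|n IH] a Ia pa; first exact: ZZ'.
by move=> y; apply: IH; [apply: Idiff | apply: pa].
Qed.

Lemma vanishing_module : translation_module vanishing.
Proof.
split=> [//|a b a0 b0 f|y a a0 f]; last exact: a0.
by rewrite a0 b0 subr0.
Qed.

Lemma poly_map_sum (I : Type) (r : seq I) (E : I -> G -> V) Z n : translation_module Z ->
  (forall i, poly_map Z n (E i)) -> poly_map Z n (fun f => \sum_(i <- r) E i f).
Proof.
move=> modZ pE; elim: r => [|i r IH].
  have [p0 _ _] := poly_map_module n modZ; move: p0.
  by congr poly_map; apply: funext => f; rewrite big_nil.
have := poly_mapD modZ (pE i) IH.
by congr poly_map; apply: funext => f; rewrite big_cons.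
Qed.

End PolynomialMaps.

Section PolynomialRing.
Local Open Scope ring_scope.
Variables (G : groupType) (K : comNzRingType).
Implicit Types (a b : G -> K).
Notation pol := (poly_map (@vanishing G K)).

Lemma poly_map_vanishing n a : vanishing a -> pol n a.
Proof. exact: (@poly_map_le _ _ _ 0 n a (@vanishing_module G K)). Qed.

Lemma poly_map_cst (c : K) : pol 1 (fun=> c).
Proof. by move=> y f; rewrite /ldiff subrr. Qed.

(** Discrete Leibniz rule, with induction on both degrees. *)
Lemma poly_mapM m n a b : pol m a -> pol n b -> pol (m + n)%N (fun f => a f * b f).
Proof.
elim: m n a b => [|m IHm] n a b pa pb.
  by apply: poly_map_vanishing => f; rewrite pa mul0r.
elim: n a b pa pb => [|n IHn] a b pa pb.
  by apply: poly_map_vanishing => f; rewrite pb mulr0.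
rewrite addnS => y; change (pol (m.+1 + n)%N (ldiff y (fun f => a f * b f))).
have -> : ldiff y (fun f => a f * b f) =
    (fun f => ldiff y a f * b (y * f)%g + a f * ldiff y b f).
  by apply: funext => f; rewrite /ldiff mulrBl mulrBr addrA subrK.
apply: (poly_mapD (@vanishing_module G K)).
  rewrite addSnnS; apply: IHm (pa y) _.
  by have [_ _ pt] := poly_map_module n.+1 (@vanishing_module G K); apply: pt.
exact: IHn pa (pb y).
Qed.

(** The successor in the bound comes from the empty product: the constant 1 needs one difference to
    vanish. *)
Lemma poly_mapX n k a : pol n a -> pol (k * n).+1%N (fun f => a f ^+ k).
Proof.
move=> pa; elim: k => [|k IH]; first exact: poly_map_cst.
rewrite mulSn -addnS; have := poly_mapM pa IH.
by congr poly_map; apply: funext => f; rewrite exprS.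
Qed.

Lemma poly_map_prod d n (a : 'I_d -> G -> K) : (forall i, pol n (a i)) ->
  pol (d * n).+1%N (fun f => \prod_i a i f).
Proof.
elim: d a => [|d IH] a pa.
  have := poly_map_cst 1; congr poly_map.
  by apply: funext => f; rewrite big_ord0.
rewrite mulSn -addnS; have := poly_mapM (pa ord0) (IH _ (fun i => pa (lift ord0 i))).
by congr poly_map; apply: funext => f; rewrite big_ord_recl.
Qed.

End PolynomialRing.

(** * Functions invariant under dimension subgroups *)

Section DimensionSubgroups.
Local Open Scope ring_scope.
Variables (K : finFieldType) (X : finType) (n : nat).
Notation G := (free_group X).
Notation A := (group_algebra K G).
Notation D := (ideal_exp (@augmentation_ideal K G)).

(** For [K] equal to ['F_p] this is [zassenhaus p n]. *)
Definition dimension_subgroup (f : G) : Prop := D n (ga_elt K f - 1).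

Lemma dimension_subgroup_congr (f g : G) :
  D n (ga_elt K f - ga_elt K g) -> dimension_subgroup (g^-1 * f)%g.
Proof.
move=> Dfg; rewrite /dimension_subgroup.
have -> : ga_elt K (g^-1 * f)%g - 1 = ga_elt K g^-1%g * (ga_elt K f - ga_elt K g).
  by rewrite mulrBr -!ga_eltM mulVg.
exact: ideal_expMl.
Qed.

(** Taking the difference by [y] turns [l (c * f)] into [l (c * (y - 1) * f)]; the induction lets
    the left factor [c] collect these elements of the augmentation ideal. *)
Lemma functional_poly_map (l : A -> K) : (forall a b, l (a - b) = l a - l b) ->
  (forall a, D n a -> l a = 0) -> poly_map (@vanishing G K) n (fun f => l (ga_elt K f)).
Proof.
move=> lB l0; suff pol_l m (c : A) : (forall a, D m a -> l (c * a) = 0) ->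
    poly_map (@vanishing G K) m (fun f => l (c * ga_elt K f)).
  have := pol_l n 1 (fun a Da => l0 _ (ideal_expMl 1 Da)).
  by congr poly_map; apply: funext => f; rewrite mul1r.
elim: m c => [|m IH] c lc0; first by move=> f; apply: lc0.
move=> y; have : poly_map (@vanishing G K) m (fun f => l (c * (ga_elt K y - 1) * ga_elt K f)).
  apply: IH => a Da; rewrite -mulrA; apply: lc0; apply: ideal_expS Da.
  exact: augmentation_eltB1.
congr poly_map; apply: funext => f.
by rewrite /ldiff -lB ga_eltM -mulrBr -mulrA mulrBl mul1r.
Qed.

(** The separating functionals map F to the finite set of points of [K^d], with fibres inside cosets
    of the dimension subgroup. An invariant function is thus a combination of indicators of points,
    and by Fermat's little theorem these are polynomials in the functionals. *)
Lemma dimension_invariant_poly_map : exists N, forall a : G -> K,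
  right_invariant (dimension_subgroup) a -> poly_map (@vanishing G K) N a.
Proof.
have [d [l [lB l0 lsep]]] := separating_functionals K X n.
pose le i f := l i (ga_elt K f).
have l_eq f g : (forall i, le i f = le i g) -> dimension_subgroup (g^-1 * f)%g.
  move=> lfg; apply: dimension_subgroup_congr; apply: lsep => i.
  by rewrite lB; apply/eqP; rewrite subr_eq0; apply/eqP/lfg.
(* [bump v] is the indicator function of the set where all [le i] equal [v i]. *)
pose bump (v : {ffun 'I_d -> K}) f := \prod_i (1 - (le i f - v i) ^+ #|K|.-1).
(* The bound [n.+1] serves for [le i - v i], also when [n] is 0; the rest comes from [poly_mapX] and
   [poly_map_prod]. *)
pose N := (d * (#|K|.-1 * n.+1).+1).+1%N.
have pol_bump v : poly_map (@vanishing G K) N (bump v).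
  apply: poly_map_prod => i; have modv := @vanishing_module G K.
  have [_ pB _] := poly_map_module (#|K|.-1 * n.+1).+1%N modv.
  apply: pB; first exact: (poly_map_le modv _ (@poly_map_cst G K 1)).
  apply: poly_mapX; have [_ {}pB _] := poly_map_module n.+1 modv.
  apply: pB; first exact/poly_mapS/functional_poly_map/l0/lB.
  exact: (poly_map_le modv _ (@poly_map_cst G K (v i))).
(* One more for the constant factor [g v]. *)
exists N.+1 => a inv_a.
have /choice[g gE] (v : {ffun 'I_d -> K}) : exists c, forall f, (forall i, le i f = v i) -> a f = c.
  have [[f0 f0v]|no] := pselect (exists f, forall i, le i f = v i); last first.
    (* An empty fibre imposes nothing; 0 is a default value. *)
    by exists 0 => f fv; case: no; exists f.
  exists (a f0) => f fv; rewrite -[f](mulVKg f0); apply: inv_a; apply: l_eq => i.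
  by rewrite fv f0v.
have -> : a = (fun f => \sum_v g v * bump v f).
  apply: funext => f; rewrite (bigD1 [ffun i => le i f]) //= [X in _ + X]big1 ?addr0.
    rewrite (gE [ffun i => le i f] f); last by move=> i; rewrite ffunE.
    rewrite /bump big1 ?mulr1 // => i _; rewrite ffunE subrr expr0n.
    by rewrite -subn1 subn_eq0 leqNgt finNzRing_gt1 subr0.
  move=> v vf; have [i vi] : exists i, le i f - v i != 0.
    apply/existsP; apply: contraNT vf => /existsPn vE; apply/eqP/ffunP => i.
    by rewrite ffunE; apply/eqP; rewrite eq_sym -subr_eq0; move: (vE i); rewrite negbK.
  have -> : bump v f = 0.
    have e : (le i f - v i) ^+ #|K|.-1 = 1.
      exact: finField_expf_pred.
    by rewrite /bump (bigD1 i) // e subrr /= mul0r.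
  by rewrite mulr0.
apply: poly_map_sum (@vanishing_module _ _) _ => v.
exact: (poly_mapM (@poly_map_cst G K (g v)) (pol_bump v)).
Qed.

End DimensionSubgroups.

(** * Integer-valued functions modulo prime powers *)

Section IntegerMaps.
Local Open Scope ring_scope.
Variable G : groupType.
Implicit Types (a : G -> int) (q : nat).

Definition divisible_map q a : Prop := forall f, (q %| a f)%Z.

Lemma divisible_map_module q : translation_module (divisible_map q).
Proof.
split=> [f|a b qa qb f|y a qa f]; first exact: dvdz0; last exact: qa.
by rewrite rpredB ?qa ?qb.
Qed.

Lemma right_invariant_ldiff (V : zmodType) (M : G -> Prop) (a : G -> V) y :
  right_invariant M a -> right_invariant M (ldiff y a).
Proof. by move=> inv_a f m Mm; rewrite /ldiff mulgA !(inv_a _ m). Qed.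

Lemma poly_map_scale q m n a :
  poly_map (divisible_map q) n a -> poly_map (divisible_map (m * q)) n (fun f => m%:Z * a f).
Proof.
elim: n a => [|n IH] a pa; first by move=> f; rewrite PoszM dvdz_mul.
move=> y; have := IH _ (pa y).
by congr poly_map; apply: funext => f; rewrite /ldiff mulrBr.
Qed.

Lemma poly_map_reduce p n a : prime p ->
  poly_map (@vanishing G 'F_p) n (fun f => (a f)%:~R) -> poly_map (divisible_map p) n a.
Proof.
move=> p_pr; elim: n a => [|n IH] a pa.
  by move=> f; rewrite (dvdz_pcharf (pchar_Fp p_pr)); apply/eqP/pa.
move=> y; apply: IH; have := pa y.
by congr poly_map; apply: funext => f; rewrite /ldiff rmorphB.
Qed.

End IntegerMaps.

(** Induction on [k]: [N0] differences make the function divisible by [p]; the quotient by [p] is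
    still invariant, so [N] further differences make it divisible by [p ^ k]. *)
Lemma zassenhaus_invariant_poly_map (X : finType) p n k : prime p ->
  exists N, forall a : free_group X -> int, right_invariant (zassenhaus p n) a ->
    poly_map (divisible_map (p ^ k)) N a.
Proof.
move=> p_pr; have [N0 pN0] := @dimension_invariant_poly_map 'F_p X n.
elim: k => [|k [N pN]].
  by exists 0 => a _ f; rewrite expn0 dvd1z.
exists (N0 + N) => a inv_a; apply: poly_map_iter.
have p_a : poly_map (divisible_map p) N0 a.
  by apply: poly_map_reduce p_pr (pN0 _ _) => f m Mm; rewrite inv_a.
apply: poly_map_sub inv_a p_a => [y b|b inv_b pb]; first exact: right_invariant_ldiff.
have : poly_map (divisible_map (p * p ^ k)) N (fun f => p%:Z * (b f %/ p)%Z)%R.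
  by apply/poly_map_scale/pN => f m Mm; rewrite inv_b.
by rewrite expnS; congr poly_map; apply: funext => f; rewrite mulrC divzK.
Qed.

(** * Lifting crossed homomorphisms *)

Section PathSums.
Local Open Scope ring_scope.
Variables (X : choiceType) (V : zmodType).
Notation F := (free_group X).
Variable L : F -> X -> V.
Implicit Types (f u v : F) (a : X * bool) (s t : seq (X * bool)).

(* [L f x] is a value attached to the edge from f to f x of the Cayley graph of F. *)
Definition edge_value f a := if a.2 then - L (f * free_letter a)%g a.1 else L f a.1.

Fixpoint path_sum f s :=
  if s is a :: s' then edge_value f a + path_sum (f * free_letter a)%g s' else 0.

Lemma edge_value_flip f a : edge_value (f * free_letter a)%g (flip a) = - edge_value f a.
Proof.
case: a => x []; rewrite /edge_value /= ?opprK //.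
by have -> := free_letterV (x, false); rewrite mulgK.
Qed.

(** Backtracking along an edge contributes zero, so a path sum survives free reduction. *)
Lemma path_sum_push f a s :
  path_sum f (push a s) = edge_value f a + path_sum (f * free_letter a)%g s.
Proof.
case: s => [|b s] //=; case: eqP => [->|//].
by rewrite edge_value_flip free_letterV mulgK addrA subrr add0r.
Qed.

Lemma path_sum_pushs f s t :
  path_sum f (pushs s t) = path_sum f s + path_sum (f * free_eval s)%g t.
Proof.
elim: s f => [|a s IH] f; first by rewrite /free_eval big_nil mulg1 add0r.
by rewrite path_sum_push IH free_eval_cons addrA mulgA.
Qed.

Lemma path_sumM f u v : path_sum f (u * v)%g = path_sum f u + path_sum (f * u)%g v.
Proof. by rewrite [LHS]path_sum_pushs free_evalK. Qed.

End PathSums.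

Definition group_pred (G : groupType) (R : G -> Prop) : Prop :=
  [/\ R 1%g, forall x y, R x -> R y -> R (x * y)%g & forall x, R x -> R x^-1%g].

Definition zmod_pred (V : zmodType) (A : V -> Prop) : Prop :=
  A 0%R /\ (forall u v, A u -> A v -> A (u - v)%R).

Section ZmodPred.
Local Open Scope ring_scope.
Variables (V : zmodType) (A : V -> Prop).
Hypothesis modA : zmod_pred A.

Lemma zmod_predN u : A u -> A (- u).
Proof. by case: modA => A0 AB Au; rewrite -[- u]add0r; apply: AB. Qed.

Lemma zmod_predD u v : A u -> A v -> A (u + v).
Proof. by case: modA => A0 AB Au Av; rewrite -[v]opprK; apply/AB/zmod_predN. Qed.

Lemma zmod_pred_sum (I : Type) (r : seq I) (E : I -> V) :
  (forall i, A (E i)) -> A (\sum_(i <- r) E i).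
Proof.
move=> AE; elim/big_rec: _ => [|i u _ Au]; first by case: modA.
exact: zmod_predD.
Qed.

Lemma zmod_pred_sym u v : A (u - v) -> A (v - u).
Proof. by move/zmod_predN; rewrite opprB. Qed.

Lemma zmod_pred_trans v u w : A (u - v) -> A (v - w) -> A (u - w).
Proof. by move=> uv vw; rewrite -(subrKA v); apply: zmod_predD. Qed.

Lemma zmod_pred_congB u v u' v' : A (u - u') -> A (v - v') -> A (u - v - (u' - v')).
Proof. by move=> uu vv; rewrite subrACA; case: modA => _; apply. Qed.

Lemma zmod_pred_congN u u' : A (u - u') -> A (- u - - u').
Proof. by move/zmod_predN; rewrite opprD. Qed.

Lemma zmod_pred_congD u v u' v' : A (u - u') -> A (v - v') -> A (u + v - (u' + v')).
Proof. by move=> uu vv; rewrite opprD addrACA; apply: zmod_predD. Qed.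

End ZmodPred.

(** Represents the coset R f; [choose] makes the result depend on the coset only. *)
Definition coset_repr (X : choiceType) (R : free_group X -> Prop) (f : free_group X) :=
  choose (fun g => `[< R (f * g^-1)%g >]) f.

Section CosetRepr.
Local Open Scope group_scope.
Variables (X : choiceType) (R : free_group X -> Prop).
Hypothesis grpR : group_pred R.

Lemma coset_reprP f : R (f * (coset_repr R f)^-1).
Proof.
have [R1 _ _] := grpR; apply/asboolP.
apply: (chooseP (P := fun g => `[< R (f * g^-1) >])); apply/asboolP.
by rewrite mulgV.
Qed.

Lemma coset_repr_eq f g : R (f * g^-1) -> coset_repr R f = coset_repr R g.
Proof.
have [R1 RM RV] := grpR; move=> Rfg; rewrite /coset_repr.
rewrite (@eq_choose _ _ (fun h => `[< R (g * h^-1) >])) => [|h].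
  by apply: choose_id; apply/asboolP; rewrite ?mulgV // -[_ * _]invgK invgM invgK; apply: RV.
apply/asboolP/asboolP => Rh.
  have := RM _ _ (RV _ Rfg) Rh; by rewrite invgM invgK -mulgA mulKg.
by have := RM _ _ Rfg Rh; rewrite -mulgA mulKg.
Qed.

End CosetRepr.

Section CrossedLift.
Local Open Scope ring_scope.
Variables (X : choiceType) (V : zmodType).
Notation F := (free_group X).
Variable act : F -> V -> V.
Hypothesis actM : forall x y v, act (x * y)%g v = act x (act y v).
Hypothesis actB : forall x u v, act x (u - v) = act x u - act x v.
Variables (R : F -> Prop) (A : V -> Prop).
Hypotheses (grpR : group_pred R) (modA : zmod_pred A).

Definition crossed (Phi : F -> V) : Prop :=
  forall x y, R x -> R y -> Phi (x * y)%g = Phi x + act x (Phi y).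

Lemma act0 x : act x 0 = 0. Proof. by rewrite -[in LHS](subrr 0) actB subrr. Qed.
Lemma actN x v : act x (- v) = - act x v.
Proof. by rewrite -[- v]sub0r actB act0 sub0r. Qed.
Lemma actD x u v : act x (u + v) = act x u + act x v.
Proof. by rewrite -{1}[v]opprK actB actN opprK. Qed.

(** Modulo [A], [phi] is a crossed homomorphism on R. It lifts because the Cayley graph of F is a
    tree: any R-equivariant function on edges can be integrated along paths. *)
Lemma crossed_lift (phi : F -> V) :
    (forall x y, R x -> R y -> A (phi (x * y)%g - (phi x + phi y))) ->
    (forall x y, R x -> R y -> A (act x (phi y) - phi y)) ->
  exists2 Phi, crossed Phi & forall x, R x -> A (Phi x - phi x).
Proof.
have [R1 RM RV] := grpR; have [A0 AB] := modA.
move=> phiM phi_act; pose t f := coset_repr R f.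
have Rt f : R (f * (t f)^-1)%g := coset_reprP grpR f.
have tE f g : R (f * g^-1)%g -> t f = t g by apply: coset_repr_eq.
have phi1 : A (phi 1%g).
  have := phiM _ _ R1 R1; rewrite mulg1 opprD addrA subrr add0r => /(zmod_predN modA).
  by rewrite opprK.
(* [psi] spreads [phi] over F along a transversal; its increments along edges, made
   exactly equivariant at the cost of an error in [A], integrate to the crossed map. *)
pose psi f := phi (f * (t f)^-1)%g.
pose L f x := act (f * (t f)^-1)%g (psi (t f * free_gen x)%g - psi (t f)).
have LE r f x : R r -> L (r * f)%g x = act r (L f x).
  move=> Rr; rewrite /L (_ : t (r * f)%g = t f); last by apply: tE; rewrite mulgK.
  by rewrite -[RHS]actM mulgA.
have ttE f : t (t f) = t f by apply/esym/tE.
(* The two sides differ by the action of [r] on values of [phi] and by the defect of additivity of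
   [phi], both in [A]. *)
have L_psi f x : A (L f x - (psi (f * free_gen x)%g - psi f)).
  rewrite /L {1 2 4}/psi ttE mulgV; set r := (f * _)%g; set g := t f.
  have Rr : R r := Rt f.
  have -> : t (g * free_gen x)%g = t (f * free_gen x)%g.
    by apply/esym/tE; rewrite invgM mulgA mulgK.
  rewrite /psi; set h := t (f * _)%g; set y := (g * free_gen x * h^-1)%g.
  have Ry : R y.
    rewrite /y (_ : h = t (g * free_gen x)%g) //; apply/tE.
    by rewrite invgM mulgA mulgK.
  have -> : (f * free_gen x * h^-1)%g = (r * y)%g by rewrite /y /r !mulgA mulgVK.
  apply: (zmod_pred_trans modA (v := phi y - phi 1%g)).
    by rewrite actB; apply: zmod_pred_congB => //; apply: phi_act.
  apply: (zmod_pred_trans modA (v := phi y)).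
    by rewrite addrAC subrr add0r; apply: zmod_predN.
  rewrite opprB addrA [phi y + _]addrC; apply: zmod_pred_sym => //.
  exact: phiM.
pose Psi f := path_sum L 1%g (free_word f).
have path_act r f s : R r -> path_sum L (r * f)%g s = act r (path_sum L f s).
  move=> Rr; elim: s f => [|a s IH] f /=; first by rewrite act0.
  rewrite -mulgA IH actD; congr (_ + _).
  by rewrite /edge_value; case: a.2; rewrite -?mulgA (LE r) ?actN.
have path_psi f s : A (path_sum L f s - (psi (f * free_eval s)%g - psi f)).
  elim: s f => [|a s IH] f /=.
    by rewrite /free_eval big_nil mulg1 !subrr.
  have -> : psi (f * free_eval (a :: s))%g - psi f = psi (f * free_letter a)%g - psi f +
      (psi (f * free_eval (a :: s))%g - psi (f * free_letter a)%g).
    by rewrite [RHS]addrC subrKA.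
  apply: zmod_pred_congD => //; last by rewrite free_eval_cons mulgA.
  case: a => x []; last exact: L_psi.
  rewrite /edge_value /= -[psi _ - _]opprB; apply: zmod_pred_congN => //.
  have := L_psi (f * free_letter (x, true))%g x.
  by have -> := free_letterV (x, false); rewrite mulgVK.
exists Psi => [x y Rx Ry|x Rx].
  by rewrite /Psi path_sumM mul1g -{2}[x]mulg1 path_act.
apply: (zmod_pred_trans modA (path_psi 1%g x)); rewrite free_evalK mul1g /psi.
rewrite (tE x 1%g); last by rewrite invg1 mulg1.
rewrite mul1g -addrA -opprD [phi _ + phi x]addrC; apply: phiM => //.
by have := Rt 1%g; rewrite mul1g.
Qed.

End CrossedLift.

(** * Identity sequences *)

Section Generated.
Local Open Scope group_scope.
Variable G : groupType.

Lemma generated_group (S : G -> Prop) : group_pred (generated S).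
Proof. by split; [exact: gen_1 | exact: gen_M | exact: gen_V]. Qed.

Lemma normal_closureJ (S : G -> Prop) w x :
  normal_closure S x -> normal_closure S (w * x * w^-1).
Proof.
elim=> [_ [v [r [Sr ->]]]||a b _ Ia _ Ib|a _ Ia].
- by apply: gen_in; exists (w * v), r; split=> //; rewrite invgM !mulgA.
- by rewrite mulg1 mulgV; apply: gen_1.
- have -> : w * (a * b) * w^-1 = (w * a * w^-1) * (w * b * w^-1).
    by rewrite !mulgA mulgVK.
  exact: gen_M.
have -> : w * a^-1 * w^-1 = (w * a * w^-1)^-1 by rewrite !invgM invgK mulgA.
exact: gen_V.
Qed.

End Generated.

Section Relators.
Local Open Scope group_scope.
Variables (X : finType) (Rel : presentation X).
Notation F := (free_group X).
Notation R := (relation_subgroup Rel).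
Notation C := (relator_conjugate Rel).
Implicit Types (c w : F) (s t : seq F).

Lemma relator_conjugateJ w c : C c -> C (w * c * w^-1).
Proof. by move=> [v [r [e [Rr ->]]]]; exists (w * v), r, e; rewrite invgM !mulgA. Qed.

Lemma relator_conjugateJV w c : C (w * c * w^-1) -> C c.
Proof. by move/(relator_conjugateJ w^-1); rewrite invgK !mulgA mulVg mul1g mulgVK. Qed.

Lemma relator_conjugateV c : C c -> C c^-1.
Proof.
move=> [v [r [e [Rr ->]]]]; exists v, r, (~~ e); split=> //.
by rewrite !invgM invgK mulgA; case: e; rewrite ?invgK.
Qed.

Lemma relator_conjugate_sub c : C c -> R c.
Proof.
move=> [v [r [e [Rr ->]]]]; have Rv : R (v * r * v^-1) by apply: gen_in; exists v, r.
by case: e => //; have := gen_V Rv; rewrite !invgM invgK mulgA.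
Qed.

Lemma relation_subgroupP a : R a -> exists2 s, forall c, c \in s -> C c & \prod_(c <- s) c = a.
Proof.
elim=> [_ [w [r [Rr ->]]]||x y _ [s Cs <-] _ [t Ct <-]|x _ [s Cs <-]].
- exists [:: w * r * w^-1]; last by rewrite big_seq1.
  by move=> c; rewrite inE => /eqP ->; exists w, r, false.
- by exists [::]; rewrite ?big_nil.
- exists (s ++ t); last by rewrite big_cat.
  by move=> c; rewrite mem_cat => /orP[/Cs|/Ct].
exists (rev [seq d^-1 | d <- s]); last by rewrite -map_rev big_map prodgV revK.
by move=> c; rewrite mem_rev => /mapP[d /Cs Cd ->]; apply: relator_conjugateV.
Qed.

Section PeifferInvariance.
Local Open Scope ring_scope.
Variables (V : zmodType) (A : V -> Prop) (g : F -> V).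
Hypothesis modA : zmod_pred A.
Hypothesis gJ : forall c y, C c -> R y -> A (g (y * c * y^-1)%g - g c).
Hypothesis gV : forall c, C c -> A (g c^-1%g + g c).

(** An exchange conjugates one entry by another, which lies in R, and leaves the sum unchanged
    modulo [A]; inserted or deleted pairs cancel because [g] is odd modulo [A]. *)
Lemma peiffer_step_sum s t : peiffer_step Rel s t -> (forall c, c \in s -> C c) ->
  (forall c, c \in t -> C c) /\ A (\sum_(c <- s) g c - \sum_(c <- t) g c).
Proof.
have cat3 (u v w : seq F) : (forall c, c \in u ++ v ++ w -> C c) <->
    [/\ forall c, c \in u -> C c, forall c, c \in v -> C c & forall c, c \in w -> C c].
  split=> [Cu|[Cu Cv Cw] c]; last by rewrite !mem_cat => /or3P[/Cu|/Cv|/Cw].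
  by split=> c cu; apply: Cu; rewrite !mem_cat cu ?orbT.
have pair c d : (forall x, x \in [:: c; d] -> C x) <-> C c /\ C d.
  split=> [Cx|[Cc Cd] x]; last by rewrite !inE => /orP[] /eqP ->.
  by split; apply: Cx; rewrite !inE eqxx ?orbT.
have sum3 (u v v' w : seq F) : \sum_(c <- u ++ v ++ w) g c - \sum_(c <- u ++ v' ++ w) g c =
    \sum_(c <- v) g c - \sum_(c <- v') g c.
  by rewrite !big_cat /= opprD addrACA subrr add0r opprD addrACA subrr addr0.
have sum0 c : C c -> A (\sum_(x <- [:: c; c^-1]%g) g x - \sum_(x <- [::]) g x).
  by move=> Cc; rewrite !big_cons !big_nil subr0 addr0 addrC; apply: gV.
case=> {}s {}t c => [d|d||Cc].
- move=> /cat3[Cs /pair[Cc Cd] Ct]; split.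
    apply/cat3; split=> //; apply/pair; split=> //.
    by have := relator_conjugateJ d^-1%g Cc; rewrite invgK.
  rewrite sum3 !big_cons !big_nil !addr0 [g c + _]addrC opprD addrACA subrr add0r.
  apply: zmod_pred_sym => //.
  have := gJ Cc (gen_V (relator_conjugate_sub Cd)); by rewrite invgK.
- move=> /cat3[Cs /pair[Cc Cd] Ct]; split.
    by apply/cat3; split=> //; apply/pair; split=> //; apply: relator_conjugateJ.
  rewrite sum3 !big_cons !big_nil !addr0 [_ + g c]addrC opprD addrACA subrr add0r.
  apply: zmod_pred_sym => //; exact/gJ/relator_conjugate_sub.
- move=> /cat3[Cs /pair[Cc _] Ct]; split.
    by move=> x; rewrite mem_cat => /orP[/Cs|/Ct].
  by rewrite -[s ++ t]/(s ++ [::] ++ t) sum3; apply: sum0.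
move=> Cst; split; last first.
  rewrite -[s ++ t]/(s ++ [::] ++ t) sum3 -opprB; exact/(zmod_predN modA)/sum0.
apply/cat3; split=> [x xs||x xt]; try by apply: Cst; rewrite mem_cat ?xs ?xt ?orbT.
by apply/pair; split=> //; apply: relator_conjugateV.
Qed.

Lemma identity_sequence_sum s : combinatorially_aspherical Rel ->
  identity_sequence Rel s -> A (\sum_(c <- s) g c).
Proof.
move=> CA ids; have [Cs _] := ids; have := CA s ids.
suff step (u v : seq F) : clos_refl_trans _ (peiffer_step Rel) u v -> (forall c, c \in u -> C c) ->
    (forall c, c \in v -> C c) /\ A (\sum_(c <- u) g c - \sum_(c <- v) g c).
  by move=> /step/(_ Cs)[_]; rewrite big_nil subr0.
elim=> {u v} [u v uv|u|u v w _ IHu _ IHv].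
- exact: peiffer_step_sum.
- by move=> Cu; split=> //; rewrite subrr; case: modA.
move=> /IHu[/IHv[Cw vw] uv]; split=> //; by apply: (zmod_pred_trans modA uv).
Qed.

End PeifferInvariance.

Lemma relator_conjugate_neq1 : combinatorially_aspherical Rel -> ~ C 1.
Proof.
(* Peiffer operations preserve the parity of the length. *)
move=> CA C1; have : identity_sequence Rel [:: 1].
  by split; [move=> c; rewrite inE => /eqP -> | rewrite big_seq1].
move=> ids; have := @identity_sequence_sum int (fun u => 2 %| u)%Z (fun=> 1%R) _ _ _ _ CA ids.
rewrite big_seq1 => even1; suff : (2 %| 1)%Z by []; apply: even1 => //.
by split=> // u v; apply: rpredB.
Qed.
End Relators.

(** * Extending functions on relators to crossed homomorphisms *)

Section RelatorSums.
Local Open Scope ring_scope.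
Variables (X : finType) (Rel : presentation X).
Notation F := (free_group X).
Notation R := (relation_subgroup Rel).
Notation C := (relator_conjugate Rel).
Variables (V : zmodType) (A B : V -> Prop) (g : F -> V).
Hypotheses (modA : zmod_pred A) (modB : zmod_pred B).
Hypothesis g_identity : forall s, identity_sequence Rel s -> A (\sum_(c <- s) g c).
Hypothesis gV : forall c, C c -> A (g c^-1%g + g c).
Hypothesis Bg : forall c, B (g c).

(** Appending to [s] the reversed inverses of [t] gives an identity sequence. *)
Lemma relator_sum_unique (s t : seq F) : (forall c, c \in s -> C c) -> (forall c, c \in t -> C c) ->
  (\prod_(c <- s) c = \prod_(c <- t) c)%g -> A (\sum_(c <- s) g c - \sum_(c <- t) g c).
Proof.
move=> Cs Ct st; pose t' := rev [seq d^-1%g | d <- t].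
have sum_t' : A (\sum_(c <- t') g c + \sum_(c <- t) g c).
  have -> : \sum_(c <- t') g c + \sum_(c <- t) g c = \sum_(c <- t) (g c^-1%g + g c).
    by rewrite big_split /= -[in RHS](big_map _ predT g) (perm_big _ (permEl (perm_rev _))).
  rewrite big_seq; elim/big_rec: _ => [|c u ct Au]; first by case: modA.
  by apply: zmod_predD => //; apply/gV/Ct.
have idst : identity_sequence Rel (s ++ t').
  split; last by rewrite big_cat /= st /t' -map_rev big_map prodgV revK mulgV.
  move=> c; rewrite mem_cat => /orP[/Cs//|]; rewrite mem_rev => /mapP[d /Ct Cd ->].
  exact: relator_conjugateV.
have := g_identity idst; rewrite big_cat /= => sum_st'.
have [_ AB] := modA; have := AB _ _ sum_st' sum_t'.
by rewrite opprD addrA addrK.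
Qed.

(** Choose for each element of R an expression as a product of relator conjugates and sum [g] over
    it; the choice matters only modulo [A]. *)
Lemma relator_sum_lift : exists2 phi : F -> V,
    (forall x y, R x -> R y -> A (phi (x * y)%g - (phi x + phi y)))
  & (forall x, B (phi x)) /\ (forall c, C c -> A (phi c - g c)).
Proof.
have /choice[s sE] (x : F) : exists s,
    R x -> (forall c, c \in s -> C c) /\ (\prod_(c <- s) c = x)%g.
  have [Rx|nRx] := pselect (R x); last by exists [::].
  by have [s Cs prod_s] := relation_subgroupP Rx; exists s.
exists (fun x => \sum_(c <- s x) g c) => [x y Rx Ry|].
  have [[Cx Px] [Cy Py]] := (sE x Rx, sE y Ry); have [Cxy Pxy] := sE _ (gen_M Rx Ry).
  rewrite -big_cat; apply: relator_sum_unique => //=; last by rewrite big_cat Px Py Pxy.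
  by move=> c; rewrite mem_cat => /orP[/Cx|/Cy].
split=> [x|c Cc]; first exact: zmod_pred_sum.
have [Cs Ps] := sE c (relator_conjugate_sub Cc).
have -> : g c = \sum_(d <- [:: c]) g d by rewrite big_seq1.
apply: relator_sum_unique => //; last by rewrite big_seq1.
by move=> d; rewrite inE => /eqP->.
Qed.

End RelatorSums.

(** * Climbing a unipotent filtration *)

Section Devissage.
Local Open Scope ring_scope.
Variables (X : finType) (Rel Rel0 : presentation X).
Notation F := (free_group X).
Notation R := (relation_subgroup Rel).
Notation R0 := (relation_subgroup Rel0).
Notation C0 := (relator_conjugate Rel0).
Hypothesis sub0 : (Rel0 `<=` Rel)%fset.
Hypothesis CA : combinatorially_aspherical Rel.
Variables (V : zmodType) (act : F -> V -> V).
Hypothesis actM : forall x y v, act (x * y)%g v = act x (act y v).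
Hypothesis actB : forall x u v, act x (u - v) = act x u - act x v.
Variables (B : V -> Prop) (A : nat -> V -> Prop).
Hypotheses (modB : zmod_pred B) (modA : forall n, zmod_pred (A n)).
Hypothesis AB : forall n v, A n v -> B v.
Hypothesis actA : forall n x v, A n.+1 v -> A n (act x v - v).
Hypothesis actR0 : forall x v, R0 x -> B v -> act x v = v.

Lemma relator_conjugate_subset c : C0 c -> relator_conjugate Rel c.
Proof. by move=> [w [r [e [Rr ->]]]]; exists w, r, e; split=> //; apply: (fsubsetP sub0). Qed.

Lemma relation_subgroup_subset x : R0 x -> R x.
Proof.
move=> /relation_subgroupP[s Cs <-]; rewrite big_seq; elim/big_rec: _ => [|c u cs Ru].
  exact: gen_1.
by apply: gen_M Ru; apply/relator_conjugate_sub/relator_conjugate_subset/Cs.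
Qed.

Definition equivariant (h : F -> V) : Prop :=
  (forall c, C0 c -> h c^-1%g = - h c) /\
  (forall c y, C0 c -> R y -> h (y * c * y^-1)%g = act y (h c)).

Lemma crossed1 Phi : crossed act R Phi -> (forall x, R x -> B (Phi x)) -> Phi 1%g = 0.
Proof.
move=> cr BPhi; have R1 : R 1%g := gen_1 _.
have := cr _ _ R1 R1; rewrite mulg1 (actR0 (gen_1 _) (BPhi _ R1)).
by move/(congr1 (fun u => u - Phi 1%g)); rewrite subrr addrK.
Qed.

(** Expand [Phi (y * c * y^-1)] by the crossed rule: since [y * c * y^-1] lies in R0 and acts
    trivially on [B], the term from [y^-1] cancels [Phi y]. *)
Lemma crossed_equivariant Phi : crossed act R Phi -> (forall x, R x -> B (Phi x)) ->
  equivariant Phi.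
Proof.
move=> cr BPhi; have Phi1 : Phi 1%g = 0 := crossed1 cr BPhi.
have PhiV x : R x -> act x (Phi x^-1%g) = - Phi x.
  move=> Rx; apply/eqP; rewrite -addr_eq0 addrC -cr ?mulgV ?Phi1 //; exact: gen_V.
have R0C c : C0 c -> R0 c := @relator_conjugate_sub _ _ c.
split=> [c Cc|c y Cc Ry].
  have Rc := relation_subgroup_subset (R0C c Cc).
  rewrite -PhiV // actR0 //; [exact: R0C | exact/BPhi/gen_V].
have Rc := relation_subgroup_subset (R0C c Cc).
rewrite cr ?cr //; try exact: gen_M; try exact: gen_V.
have -> : act (y * c)%g (Phi y^-1%g) = - Phi y.
  rewrite -{1}(mulgVK y (y * c)%g) actM PhiV // actR0 //; last exact/(zmod_predN modB)/BPhi.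
  exact/R0C/relator_conjugateJ.
by rewrite addrC addKr.
Qed.

(** Modulo [A n] the action on values of [h] is trivial, so asphericity of [Rel] yields a
    homomorphism on R modulo [A n], and [crossed_lift] makes it a crossed homomorphism. *)
Lemma devissage_step n h : equivariant h -> (forall c, C0 c -> A n.+1 (h c)) ->
  exists Phi, [/\ crossed act R Phi, forall x, R x -> B (Phi x)
                & forall c, C0 c -> A n (h c - Phi c)].
Proof.
(* Extension by zero to the other relators of [Rel] keeps oddness and invariance, as [C0] is closed
   under conjugation and inversion. *)
move=> [hV hJ] Ah; pose g c := if `[< C0 c >] then h c else 0.
have gE c : C0 c -> g c = h c by rewrite /g => /asboolT ->.
have g0 c : ~ C0 c -> g c = 0 by rewrite /g => /asboolF ->.
have Ag c : A n.+1 (g c).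
  by have [/[dup] Cc /gE ->|/g0 ->] := pselect (C0 c); [apply: Ah | case: (modA n.+1)].
have gJ c y : R y -> A n (g (y * c * y^-1)%g - g c).
  move=> Ry; have [Cc|nCc] := pselect (C0 c); last first.
    rewrite !g0 ?subrr //; first by case: (modA n).
    by move/relator_conjugateJV.
  rewrite !gE //; last exact: relator_conjugateJ.
  by rewrite hJ //; apply/actA/Ah.
have gV c : A n (g c^-1%g + g c).
  have [A0 _] := modA n; have [Cc|nCc] := pselect (C0 c); last first.
    by rewrite !g0 ?addr0 // => /relator_conjugateV; rewrite invgK.
  by rewrite !gE ?hV ?addNr //; apply: relator_conjugateV.
have [phi phiM [Aphi phig]] := @relator_sum_lift X Rel V (A n) (A n.+1) g (modA n) (modA n.+1)
  (fun s => identity_sequence_sum (modA n) (fun c y _ => gJ c y) (fun c _ => gV c) CA)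
  (fun c _ => gV c) Ag.
have [Phi Phi_crossed Phi_phi] := crossed_lift actM actB (generated_group _) (modA n) phiM
  (fun x y _ _ => actA x (Aphi y)).
exists Phi; split=> // [x Rx|c Cc].
  rewrite -[Phi x](subrK (phi x)); apply: zmod_predD => //.
    exact/AB/Phi_phi.
  exact: AB (Aphi x).
rewrite -(gE c Cc); apply: zmod_pred_sym => //.
have Cc' := relator_conjugate_subset Cc.
by apply: (zmod_pred_trans (modA n) (Phi_phi c (relator_conjugate_sub Cc'))); apply: phig.
Qed.

(** Subtracting the [Phi] of one step leaves an equivariant function with values one layer deeper;
    the crossed homomorphisms add up. *)
Lemma devissage n h : equivariant h -> (forall c, C0 c -> A n (h c)) ->
  exists Phi, [/\ crossed act R Phi, forall x, R x -> B (Phi x)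
                & forall c, C0 c -> A 0 (h c - Phi c)].
Proof.
elim: n h => [|n IH] h eqh Ah.
  exists (fun=> 0); split=> [x y _ _|x _|c Cc].
  - by rewrite act0 ?addr0.
  - by case: modB.
  by rewrite subr0; apply: Ah.
have [Phi [crPhi BPhi hPhi]] := devissage_step eqh Ah.
have [h'V h'J] : equivariant (fun c => h c - Phi c).
  have [hV hJ] := eqh; have [PV PJ] := crossed_equivariant crPhi BPhi.
  by split=> [c Cc|c y Cc Ry]; rewrite ?hV ?PV ?hJ ?PJ ?actB ?opprD.
have [Psi [crPsi BPsi hPsi]] := IH _ (conj h'V h'J) hPhi.
exists (fun x => Phi x + Psi x); split=> [x y Rx Ry|x Rx|c Cc].
- by rewrite crPhi ?crPsi // (actD actB) addrACA.
- by apply: zmod_predD => //; [apply: BPhi | apply: BPsi].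
by rewrite opprD addrA; apply: hPsi.
Qed.

Lemma crossed_prod Phi s : crossed act R Phi -> (forall x, R x -> B (Phi x)) ->
  (forall c, c \in s -> C0 c) -> Phi (\prod_(c <- s) c)%g = \sum_(c <- s) Phi c.
Proof.
move=> cr BPhi; elim: s => [_|c s IH Cs]; first by rewrite !big_nil crossed1.
have Cs' : forall d, d \in s -> C0 d by move=> d ds; apply: Cs; rewrite inE ds orbT.
have /relator_conjugate_sub R0c : C0 c by apply: Cs; rewrite mem_head.
have Rs : R (\prod_(d <- s) d)%g.
  apply: relation_subgroup_subset; rewrite big_seq; elim/big_rec: _ => [|d u ds Ru].
    exact: gen_1.
  by apply: gen_M Ru; apply/relator_conjugate_sub/Cs'.
rewrite !big_cons cr //; last exact: relation_subgroup_subset.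
by rewrite actR0 //; [rewrite IH | apply: BPhi].
Qed.

(** On R0 a crossed homomorphism is additive, so [Phi] sums to zero over the identity sequence and
    only the error [h c - Phi c] in [A 0] remains. *)
Lemma devissage_sum n h s : equivariant h -> (forall c, C0 c -> A n (h c)) ->
  identity_sequence Rel0 s -> A 0 (\sum_(c <- s) h c).
Proof.
move=> eqh Ah [Cs prod_s]; have [Phi [cr BPhi hPhi]] := devissage eqh Ah.
have -> : \sum_(c <- s) h c = \sum_(c <- s) (h c - Phi c).
  by rewrite sumrB -(crossed_prod cr) // prod_s crossed1 // subr0.
rewrite big_seq; elim/big_rec: _ => [|c u cs Au]; first by case: (modA 0).
by apply: zmod_predD => //; apply/hPhi/Cs.
Qed.

End Devissage.

(** * Signed class counts *)

Section ConjugacyCounts.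
Local Open Scope group_scope.
Variables (G : groupType) (U : G -> Prop).
Hypothesis grpU : group_pred U.

Definition conjugate_under (c d : G) : Prop := exists u, U u /\ d = u * c * u^-1.

Lemma conjugate_under_sym c d : conjugate_under c d -> conjugate_under d c.
Proof.
case: grpU => _ _ UV [u [Uu ->]]; exists u^-1; split; first exact: UV.
by rewrite invgK !mulgA mulVg mul1g mulgVK.
Qed.

Lemma conjugate_under_trans c d e :
  conjugate_under c d -> conjugate_under d e -> conjugate_under c e.
Proof.
case: grpU => _ UM _ [u [Uu ->]] [v [Uv ->]]; exists (v * u); split; first exact: UM.
by rewrite invgM !mulgA.
Qed.

(** The odd indicator of the U-class of [c0]: it is -1 on the class of [c0^-1], and 0 throughout if
    the two classes coincide. *)
Definition class_sign (c0 c : G) : int :=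
  (`[< conjugate_under c0 c >]%:Z - `[< conjugate_under c0 c^-1 >]%:Z)%R.

Lemma class_signV c0 c : class_sign c0 c^-1 = (- class_sign c0 c)%R.
Proof. by rewrite /class_sign invgK opprB. Qed.

Lemma class_signJ c0 c u : U u -> class_sign c0 (u^-1 * c * u) = class_sign c0 c.
Proof.
move=> Uu; have [_ _ UV] := grpU.
have cJ d : conjugate_under d (u^-1 * d * u).
  by exists u^-1; rewrite invgK; split=> //; apply: UV.
have eq_conj d : `[< conjugate_under c0 (u^-1 * d * u) >] = `[< conjugate_under c0 d >].
  apply/asboolP/asboolP => c0d.
    exact: conjugate_under_trans c0d (conjugate_under_sym (cJ d)).
  exact: conjugate_under_trans c0d (cJ d).
have cV : (u^-1 * c * u)^-1 = u^-1 * c^-1 * u by rewrite !invgM invgK mulgA.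
by rewrite /class_sign cV !eq_conj.
Qed.

End ConjugacyCounts.

Section RelatorCounts.
Local Open Scope ring_scope.
Variables (X : finType) (Rel Rel0 : presentation X) (p n : nat).
Notation F := (free_group X).
Notation R0 := (relation_subgroup Rel0).
Hypothesis sub0 : (Rel0 `<=` Rel)%fset.
Hypothesis CA : combinatorially_aspherical Rel.
Hypothesis p_pr : prime p.
Notation M := (@zassenhaus F p n).
Notation U := (generated (set_mul R0 M)).

Lemma zassenhaus1 : M 1%g.
Proof. by rewrite /zassenhaus subrr; apply: ideal_exp0. Qed.

Lemma set_mul_relation x : R0 x -> set_mul R0 M x.
Proof. by move=> Rx; exists x, 1%g; rewrite mulg1; split=> //; apply: zassenhaus1. Qed.

Lemma set_mul_zassenhaus x : M x -> set_mul R0 M x.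
Proof. by move=> Mx; exists 1%g, x; rewrite mul1g; split=> //; apply: gen_1. Qed.

(** Dévissage applies to the function-valued [h], which records the signs of all conjugates of [c]:
    it is equivariant under F, although [class_sign] is only U-invariant. *)
Lemma class_sign_sum_dvd k (c0 : F) s : identity_sequence Rel0 s ->
  ((p ^ k)%N %| \sum_(c <- s) class_sign U c0 c)%Z.
Proof.
move=> ids; have [N pN] := zassenhaus_invariant_poly_map X n k p_pr.
pose act (x : F) (v : F -> int) f := v (x^-1 * f)%g.
pose B (v : F -> int) := right_invariant U v.
(* Here [act x v - v] is the difference of [v] by [x^-1], so it lowers [m]; members of [A 0] are
   divisible by [p ^ k]. *)
pose A m (v : F -> int) := B v /\ poly_map (divisible_map (p ^ k)) m v.
pose h (c : F) : F -> int := fun f => class_sign U c0 (f^-1 * c * f)%g.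
have grpU : group_pred U := generated_group _.
have modB : zmod_pred B.
  by split=> // u v Bu Bv f m Um; rewrite -[LHS]/(u _ - v _) Bu // Bv.
have modA m : zmod_pred (A m).
  have [p0 pB _] := poly_map_module m (divisible_map_module F (p ^ k)); case: modB => B0 BB.
  by split=> // u v [Bu pu] [Bv pv]; split; [apply: BB | apply: pB].
have Bh c : B (h c).
  move=> f u Uu; rewrite /h -(class_signJ grpU c0 (f^-1 * c * f)%g Uu).
  by rewrite invgM !mulgA.
have Ah c : A N (h c).
  split=> //; apply: pN => f m Mm; apply: Bh; exact/gen_in/set_mul_zassenhaus.
have eqh : equivariant Rel Rel0 act h.
  split=> [c _|c y _ _]; apply: funext => f; rewrite /h /act.
    have -> : (f^-1 * c^-1 * f = (f^-1 * c * f)^-1)%g by rewrite !invgM invgK mulgA.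
    exact: class_signV.
  by rewrite invgM invgK !mulgA.
have := @devissage_sum X Rel Rel0 sub0 CA (F -> int) act _ _ B A modB modA _ _ _ N h s eqh
  (fun c _ => Ah c) ids.
(* Evaluation at 1 recovers the signs themselves. *)
have sumE : (\sum_(c <- s) h c) 1%g = \sum_(c <- s) class_sign U c0 c.
  elim: {ids} s => [|c s IH]; first by rewrite !big_nil.
  rewrite !big_cons -IH -[LHS]/(h c 1%g + _) /h; congr (class_sign _ _ _ + _).
  by rewrite invg1 mul1g mulg1.
case.
- by move=> x y v; apply: funext => f; rewrite /act invgM mulgA.
- by [].
- by move=> m v [].
- move=> m x v [Bv pv]; split; last exact: pv.
  exact: right_invariant_ldiff Bv.
- move=> x v Rx Bv; apply: funext => f; rewrite /act.
  (* By normality of R0, left translation by [x^-1] becomes right translation by an element of U. *)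
  have -> : (x^-1 * f = f * (f^-1 * x^-1 * f))%g by rewrite !mulgA mulgV mul1g.
  apply/Bv/gen_in/set_mul_relation.
  by have := normal_closureJ f^-1%g (gen_V Rx); rewrite invgK.
by move=> _ /(_ 1%g); rewrite sumE.
Qed.

Lemma class_sign_sum0 (c0 : F) s : identity_sequence Rel0 s ->
  \sum_(c <- s) class_sign U c0 c = 0.
Proof.
move=> ids; set m := \sum_(c <- s) _; have p1 := prime_gt1 p_pr.
apply/eqP; rewrite -absz_eq0; apply: contraT; rewrite -lt0n => m0.
(* The exponent is the absolute value of [m] itself, since [p ^ m] exceeds [m]. *)
have := dvdn_leq m0 (class_sign_sum_dvd `|m|%N c0 ids).
by rewrite leqNgt ltn_expl.
Qed.

End RelatorCounts.

(** * Separation of the quotient by signed counts *)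

Section TorsionFree.
Local Open Scope group_scope.
Variables (X : finType) (Rel Rel0 : presentation X) (p n : nat).
Notation F := (free_group X).
Notation R0 := (relation_subgroup Rel0).
Notation C0 := (relator_conjugate Rel0).
Hypothesis sub0 : (Rel0 `<=` Rel)%fset.
Hypothesis CA : combinatorially_aspherical Rel.
Hypothesis p_pr : prime p.
Notation M := (@zassenhaus F p n).
Notation U := (generated (set_mul R0 M)).
Notation B0 := (commutator R0 (set_mul R0 M)).
Implicit Types (x y c : F) (s : seq F).

(** From the set of products to the subgroup it generates, by [[~ x, y * z] = [~ x, y] *
    [~ x ^ y, z]] and normality of R0. *)
Lemma commutator_generated x y : R0 x -> U y -> B0 [~ x, y].
Proof.
move=> Rx Uy; elim: Uy x Rx => {y} [y My||y z _ IHy _ IHz|y _ IH] x Rx.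
- by apply: gen_in; exists x, y.
- by rewrite commg1; apply: gen_1.
- have -> : [~ x, y * z] = [~ x, y] * [~ x ^ y, z].
    by rewrite !commgEl conjgM -mulgA mulVKg.
  apply: gen_M (IHy _ Rx) (IHz _ _); rewrite /conjg.
  by have := normal_closureJ y^-1 Rx; rewrite invgK mulgA.
have -> : [~ x, y^-1] = [~ x ^ y^-1, y]^-1.
  by rewrite !commgEl conjgKV invgM invgK.
apply/gen_V/IH; rewrite /conjg invgK.
by have := normal_closureJ y Rx; rewrite mulgA.
Qed.

(** Sums over identity sequences of [Rel0] vanish exactly, so [relator_sum_lift] applies with zero
    error module. *)
Lemma class_sign_hom (c0 : F) : exists kappa : F -> int,
  (forall x y, R0 x -> R0 y -> kappa (x * y) = (kappa x + kappa y)%R) /\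
  (forall c, C0 c -> kappa c = class_sign U c0 c).
Proof.
have [] := @relator_sum_lift X Rel0 int (fun u => u = 0%R) (fun=> True) (class_sign U c0).
- by split=> // u v -> ->.
- by [].
- by move=> s; apply: (class_sign_sum0 n sub0 CA p_pr).
- by move=> c _; rewrite class_signV addNr.
- by [].
move=> kappa kM [_ kC]; exists kappa; split=> [x y Rx Ry|c Cc].
  by apply/eqP; rewrite -subr_eq0; apply/eqP/kM.
by apply/eqP; rewrite -subr_eq0; apply/eqP/kC.
Qed.

(** A relator conjugate to its inverse would be trivial, which asphericity forbids. *)
Lemma class_sign_refl c : C0 c -> class_sign U c c = 1%R.
Proof.
move=> Cc; rewrite /class_sign asboolT; last first.
  by exists 1; rewrite mul1g invg1 mulg1; split=> //; apply: gen_1.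
rewrite asboolF // => -[u [_ /esym/conjugate_inverse c1]].
by apply: (relator_conjugate_neq1 CA); rewrite -c1; apply: relator_conjugate_subset Cc.
Qed.

Lemma class_sign_neg c0 c : (class_sign U c0 c < 0)%R -> conjugate_under U c0 c^-1.
Proof.
rewrite /class_sign; have [//|nc] := pselect (conjugate_under U c0 c^-1).
by rewrite (asboolF nc) subr0; case: asbool.
Qed.

(** Induction on length: the first factor [c] counts 1 in its own class, so a later factor [d] is
    U-conjugate to [c^-1]. Modulo commutators [d] moves next to [c] and the pair disappears. *)
Lemma balanced_prod s : (forall c, c \in s -> C0 c) ->
  (forall c0, \sum_(c <- s) class_sign U c0 c = 0)%R -> B0 (\prod_(c <- s) c).
Proof.
have grpU : group_pred U := generated_group _.
have prodR t : (forall c, c \in t -> C0 c) -> R0 (\prod_(c <- t) c).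
  move=> Ct; rewrite big_seq; elim/big_rec: _ => [|c x ct Rx]; first exact: gen_1.
  by apply: gen_M Rx; apply/relator_conjugate_sub/Ct.
have [m] := ubnP (size s); elim: m s => // m IH [_ _ _|c s]; first by rewrite big_nil; apply: gen_1.
rewrite /= ltnS => le_s Cs sum0.
have Cc : C0 c by apply: Cs; rewrite mem_head.
have {}Cs d : d \in s -> C0 d by move=> ds; apply: Cs; rewrite inE ds orbT.
have [d ds neg_d] : exists2 d, d \in s & (class_sign U c d < 0)%R.
  apply/hasP/negbNE/negP => /hasPn pos; have := sum0 c.
  rewrite big_cons class_sign_refl // big_seq => /eqP; apply/negP.
  rewrite gt_eqF // ltr_wpDr //.
  apply: sumr_ge0 => d /pos; by rewrite -leNgt.
have [u [Uu dV]] := class_sign_neg neg_d.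
case/splitPr: ds le_s Cs sum0 => s1 s2 le_s Cs sum0.
have Cs12 e : e \in s1 ++ s2 -> C0 e.
  by rewrite mem_cat => es; apply: Cs; rewrite mem_cat inE orbCA es orbT.
(* The pair contributes zero to every count, so the shorter sequence is still balanced. *)
have cd0 c0 : (class_sign U c0 c + class_sign U c0 d = 0)%R.
  have UuV : U u^-1 by apply: gen_V.
  rewrite -[d]invgK class_signV dV; have := class_signJ grpU c0 c UuV.
  by rewrite invgK => ->; rewrite subrr.
have B12 : B0 (\prod_(e <- s1 ++ s2) e).
  apply: (IH _ _ Cs12) => [|c0]; first by move: le_s; rewrite !size_cat /= addnS => /ltnW.
  rewrite -[RHS](sum0 c0) big_cons !big_cat big_cons /=.
  by rewrite [RHS]addrCA [(class_sign _ _ c + _)%R]addrA cd0 add0r.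
have Rd : R0 d by apply/relator_conjugate_sub/Cs; rewrite mem_cat mem_head orbT.
have R1 : R0 (\prod_(e <- s1) e) by apply: prodR => e es; apply: Cs12; rewrite mem_cat es.
have Bcd : B0 (c * d).
  have -> : c * d = [~ c^-1, u^-1].
    by rewrite -[d in LHS]invgK dV commgEl /conjg !invgK !invgM invgK !mulgA.
  by apply: commutator_generated; apply: gen_V => //; apply: relator_conjugate_sub.
set P1 := \prod_(e <- s1) e in R1; set P2 := \prod_(e <- s2) e.
have Bd1 : B0 [~ d, P1^-1].
  by apply: commutator_generated => //; apply/gen_V/gen_in/set_mul_relation.
have -> : \prod_(e <- c :: s1 ++ d :: s2) e = c * d * [~ d, P1^-1] * (P1 * P2).
  rewrite big_cons big_cat big_cons /= commgEl /conjg invgK -/P1 -/P2.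
  by rewrite !mulgA mulgVK mulgK.
by apply: gen_M (gen_M Bcd Bd1) _; move: B12; rewrite big_cat.
Qed.

(** Each count [kappa] kills [B0] and takes values in the torsion-free group of integers, so it
    kills [a]; then any expression of [a] is balanced. *)
Lemma quotient_no_ptorsion_relation : quotient_no_ptorsion p R0 B0.
Proof.
move=> a k Ra Ba; have [s Cs sE] := relation_subgroupP Ra; rewrite -sE.
apply: balanced_prod => // c0.
have [kappa [kM kC]] := class_sign_hom c0.
have k1 : kappa 1 = 0%R.
  have := kM 1 1 (gen_1 _) (gen_1 _); rewrite mulg1 => /(congr1 (fun u => u - kappa 1%g)%R).
  by rewrite subrr addrK.
have kV x : R0 x -> kappa x^-1 = (- kappa x)%R.
  move=> Rx; apply/eqP; rewrite -addr_eq0 -kM ?mulVg ?k1 //; exact: gen_V.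
have RJ x y : R0 x -> R0 (x ^ y).
  by move=> Rx; have := normal_closureJ y^-1 Rx; rewrite invgK /conjg mulgA.
have k_prod t : (forall c, c \in t -> C0 c) ->
    R0 (\prod_(c <- t) c) /\ kappa (\prod_(c <- t) c) = (\sum_(c <- t) class_sign U c0 c)%R.
  elim: t => [|c t IH] Ct; first by rewrite !big_nil; split=> //; apply: gen_1.
  have [|Rt kt] := IH; first by move=> d dt; apply: Ct; rewrite inE dt orbT.
  have Cc : C0 c by apply: Ct; rewrite mem_head.
  have Rc := relator_conjugate_sub Cc.
  by rewrite !big_cons kM // kC // kt; split=> //; apply: gen_M.
have kJ x y : R0 x -> U y -> kappa (x ^ y) = kappa x.
  move=> /relation_subgroupP[t Ct <-] Uy.
  have Ct' c : c \in [seq c ^ y | c <- t] -> C0 c.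
    move=> /mapP[d /Ct Cd ->]; rewrite /conjg mulgA.
    by have := relator_conjugateJ y^-1 Cd; rewrite invgK.
  have -> : (\prod_(c <- t) c) ^ y = \prod_(c <- [seq c ^ y | c <- t]) c.
    by rewrite big_map conjg_prod.
  rewrite (k_prod _ Ct').2 (k_prod _ Ct).2 big_map; apply: eq_bigr => c _.
  by rewrite /conjg mulgA class_signJ //; apply: generated_group.
have kX m : R0 (a ^+ m) /\ kappa (a ^+ m) = (kappa a *+ m)%R.
  elim: m => [|m [Rm km]]; first by rewrite expg0 k1; split=> //; apply: gen_1.
  by rewrite expgS kM // km mulrS; split=> //; apply: gen_M.
have kB x : B0 x -> R0 x /\ kappa x = 0%R.
  elim=> {x} [_ [x [y [Rx /gen_in Uy ->]]]||x y _ [Rx kx] _ [Ry ky]|x _ [Rx kx]].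
  - have [Rxy RxV] : R0 (x ^ y) /\ R0 x^-1 by split; [apply: RJ | apply: gen_V].
    by rewrite commgEl kM // kV // kJ // addNr; split=> //; apply: gen_M.
  - by rewrite k1; split=> //; apply: gen_1.
  - by rewrite kM // kx ky; split=> //; apply: gen_M.
  by rewrite kV // kx oppr0; split=> //; apply: gen_V.
rewrite -(k_prod _ Cs).2 sE; have [_ /eqP] := kB _ Ba; rewrite (kX _).2.
by rewrite mulrn_eq0 expn_eq0 -leqn0 leqNgt prime_gt0 // => /eqP.
Qed.
End TorsionFree.

Theorem proposition3 (X : finType) (Rel : presentation X) :
  combinatorially_aspherical Rel ->
  quasirational Rel /\
  (forall Rel0 : presentation X, (Rel0 `<=` Rel)%fset -> quasirational Rel0).
Proof.
(* The case [Rel0 = Rel] of the second claim gives the first. *)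
move=> CA; have sub Rel0 : (Rel0 `<=` Rel)%fset -> quasirational Rel0.
  by move=> sub0 n p _ p_pr; apply: quotient_no_ptorsion_relation sub0 CA p_pr.
by split=> //; apply/sub/fsubset_refl.
Qed.
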